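(* Let $B$ be a Polish metric space and let $\mathcal{X}=(X,d_X,\pi_X,\mu_X)$ and $\mathcal{Y}=(Y,d_Y,\pi_Y,\mu_Y)$ be $mm$-fields over $B$. Then: (i) $d_{HI}(VR^{*,*}(\mathcal{X}),VR^{*,*}(\mathcal{Y}))\le 2\,d_{GH}(\mathcal{X},\mathcal{Y})$; (ii) $d_{HI}(VR^{*,*,*}(\mathcal{X}),VR^{*,*,*}(\mathcal{Y}))\le 2\,d_{GP}(\mathcal{X},\mathcal{Y})$.
   Context: A Polish metric space is a complete separable metric space. Fix a Polish metric space $(B,d_B)$. A $B$-field is a triple $(X,d_X,\pi_X)$ with $(X,d_X)$ a Polish metric space and $\pi_X\colon X\to B$ 1-Lipschitz; an $mm$-field over $B$ is a quadruple $(X,d_X,\pi_X,\mu_X)$ with in addition a Borel probability measure $\mu_X$ on $X$. An isometric embedding $\Phi\colon\mathcal{X}\Rightarrow\mathcal{Z}$ over $B$ is a distance-preserving map $\phi\colon X\to Z$ with $\pi_Z\circ\phi=\pi_X$. $d_{GH}(\mathcal{X},\mathcal{Y}):=\inf d_H^Z(\phi(X),\psi(Y))$ (computed on underlying $B$-fields) and $d_{GP}(\mathcal{X},\mathcal{Y}):=\inf d_P^Z(\phi_*(\mu_X),\psi_*(\mu_Y))$, where both infima are over all $B$-fields $\mathcal{Z}=(Z,d_Z,\pi_Z)$ and isometric embeddings $\Phi\colon\mathcal{X}\Rightarrow\mathcal{Z}$, $\Psi\colon\mathcal{Y}\Rightarrow\mathcal{Z}$ over $B$; $d_H^Z$ and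 $d_P^Z$ are the Hausdorff and Prokhorov distances in $Z$. The radius of $C\subseteq B$ is $\mathrm{rad}(C)=\inf_{b\in B}\sup_{c\in C}d_B(b,c)$. Suprema of nonnegative quantities over the empty set are $0$. Metric field Vietoris-Rips bifiltration: $VR^{r,s}(\mathcal{X})$, $r,s\ge0$, is the simplicial complex with vertices in $X$ whose simplices are the finite nonempty $A\subseteq X$ with $\mathrm{diam}(A)\le r$ and $\mathrm{rad}(\pi_X(A))\le s/2$. $mm$-field Vietoris-Rips trifiltration: $VR^{r,s,t}(\mathcal{X})$, $r,s,t\ge0$, is the simplicial complex whose vertices are Borel subsets of $X$ (the empty set is not excluded) and whose simplices are the finite nonempty chains $\{A_0,\dots,A_n\}$, $A_0\subseteq\dots\subseteq A_n\subseteq X$, with $\mathrm{diam}(A_i)\le r$, $\mathrm{rad}(\pi_X(A_i))\le s/2$ and $\mu_X(A_i)\ge1-t$ for all $i$. These are viewed, through geometric realization and inclusions, as functors from the poset $[0,\infty)^k$ ($k=2,3$) to topological spaces. Two functors $M,N$ are $\delta$-interleaved if there are natural transformations $M^{a}\to N^{a+\delta(1,\dots,1)}$ and $N^{a}\to M^{a+\delta(1,\dots,1)}$ whose composites are the structure maps of $M$ and $N$ (shift by $2\delta$). They are weakly equivalent if they are connected by a zigzag of natural transformations that are objectwise weak homotopy equivalences. $M,N$ are $\delta$-homotopy-interleaved if there are $M'$ weakly equivalent to $M$ and $N'$ weakly equivalent to $N$ with $M',N'$ $\delta$-interleaved. The homotopy interleaving distance $d_{HI}(M,N)$ is the infimum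 of such $\delta$ ($\infty$ if none). *)

(* Defs.v *)
From HB Require Import structures.
From Stdlib Require Import Relation_Operators.
From mathcomp Require Import all_boot all_order all_algebra.
From mathcomp Require Import all_classical all_reals all_analysis.

Set Implicit Arguments.
Unset Strict Implicit.
Unset Printing Implicit Defensive.

Import Order.TTheory GRing.Theory Num.Theory.
Import numFieldNormedType.Exports.

Local Open Scope classical_set_scope.
Local Open Scope ring_scope.

Section metric.
Context {R : realType}.
Implicit Types T : metricType R.

Definition complete_metric T :=
  forall u : nat -> T, cauchy (u @ \oo) -> exists l : T, u @ \oo --> l.

Definition separable_metric T := exists2 S : set T, countable S & dense S.

Definition polish_metric T := complete_metric T /\ separable_metric T.

(* Supremum of a set of nonnegative quantities, with value 0 on the empty set
   (the library's [ereal_sup set0] is [-oo]). *)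
Definition sup0 (S : set (\bar R)) : \bar R := ereal_sup (0%E |` S).

Definition diam T (A : set T) : \bar R :=
  sup0 [set (mdist p.1 p.2)%:E | p in A `*` A].

Definition rad T (C : set T) : \bar R :=
  ereal_inf [set sup0 [set (mdist b c)%:E | c in C] | b in [set: T]].

Definition thickening T (A : set T) (e : R) : set T :=
  [set x | exists2 a, A a & mdist a x < e].

Definition hausdorff_dist T (A C : set T) : \bar R :=
  ereal_inf [set e%:E | e in [set e : R |
    [/\ 0 < e, A `<=` thickening C e & C `<=` thickening A e]]].

Definition borel {T : topologicalType} : set (set T) := <<s @open T >>.

Definition prokhorov_dist T (m1 m2 : set T -> \bar R) : \bar R :=
  ereal_inf [set e%:E | e in [set e : R | 0 < e /\
    forall A : set T, borel A ->
      (m1 A <= m2 (thickening A e) + e%:E)%E /\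
      (m2 A <= m1 (thickening A e) + e%:E)%E]].

End metric.

(* [T] with its Borel sigma-algebra.  The library's measurable types are
   pointed, whence the parameter [t0], which plays no other role. *)
Definition borel_space (T : topologicalType) (t0 : T) : Type := T.

Section borel_space.
Variables (T : topologicalType) (t0 : T).

HB.instance Definition _ := Choice.on (borel_space t0).
HB.instance Definition _ := isPointed.Build (borel_space t0) t0.

Let borel_setC (A : set (borel_space t0)) : @borel T A -> @borel T (~` A).
Proof. by move=> bA; rewrite -setTD; exact: sigma_algebraCD. Qed.

HB.instance Definition _ := @isMeasurable.Build (sigma_display (@open T))
  (borel_space t0) (@borel T) (@sigma_algebra0 _ setT (@open T))
  borel_setC (@sigma_algebra_bigcup _ setT (@open T)).

End borel_space.

Record bField (R : realType) (B : metricType R) := BField {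
  bf_space :> metricType R ;
  bf_polish : polish_metric bf_space ;
  bf_proj : bf_space -> B ;
  bf_proj_lip : forall x y, mdist (bf_proj x) (bf_proj y) <= mdist x y }.

(* The total mass being 1, an mm-field is never empty: [mm_point] is only there
   for [borel_space]. *)
Record mmField (R : realType) (B : metricType R) := MMField {
  mm_field :> bField B ;
  mm_point : mm_field ;
  mm_measure : probability (borel_space mm_point) R }.

Section field_distances.
Context {R : realType} {B : metricType R}.

Definition field_embedding (X Z : bField B) (f : X -> Z) :=
  (forall x y, mdist (f x) (f y) = mdist x y) /\
  (forall x, bf_proj (f x) = bf_proj x).

Definition d_GH (X Y : bField B) : \bar R :=
  ereal_inf [set d | exists (Z : bField B) (f : X -> Z) (g : Y -> Z),
    [/\ field_embedding f, field_embedding g &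
        d = hausdorff_dist (range f) (range g)]].

(* [fun A => mu (f @^-1` A)] is the push-forward of [mu] along [f]. *)
Definition d_GP (X Y : mmField B) : \bar R :=
  ereal_inf [set d | exists (Z : bField B) (f : X -> Z) (g : Y -> Z),
    [/\ field_embedding f, field_embedding g &
        d = prokhorov_dist (fun A : set Z => mm_measure X (f @^-1` A))
                           (fun A : set Z => mm_measure Y (g @^-1` A))]].

End field_distances.

(* An element of [V] is a vertex of the complex only if its singleton is a
   simplex. *)
Record simplicial_complex (V : choiceType) := SimplicialComplex {
  simplex : set (set V) ;
  simplex_finite : forall s, simplex s -> finite_set s ;
  simplex_neq0 : forall s, simplex s -> s !=set0 ;
  simplex_face : forall s u, simplex s -> u `<=` s -> u !=set0 -> simplex u }.

Section realization.
Context {R : realType} {V : choiceType}.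
Implicit Types K L : simplicial_complex V.

(* Points are given by their barycentric coordinates. *)
Record realization K := Realization {
  coord : V -> R ;
  coord_ge0 : forall v, 0 <= coord v ;
  coord_simplex : simplex K [set v | coord v != 0] ;
  coord_sum1 : \sum_(v \in [set: V]) coord v = 1 }.

HB.instance Definition _ K := gen_eqMixin (realization K).
HB.instance Definition _ K := gen_choiceMixin (realization K).

Definition closed_cell K (s : set V) : set (realization K) :=
  [set x | [set v | coord x v != 0] `<=` s].

(* Weak (coherent) topology: a set is open iff its trace on every closed cell
   is open for the Euclidean topology of that cell. *)
Definition realization_open K : set (set (realization K)) :=
  [set U | forall s, simplex K s -> forall x, U x -> closed_cell s x ->
    exists2 e : R, 0 < e & forall y, closed_cell s y ->
      (forall v, s v -> `|coord x v - coord y v| < e) -> U y].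

Let realization_openT K : realization_open [set: realization K].
Proof. by move=> s _ x _ _; exists 1. Qed.

Let realization_openI K : setI_closed (@realization_open K).
Proof.
move=> U W oU oW s Ks x [Ux Wx] sx.
have [e e0 eU] := oU s Ks x Ux sx; have [d d0 dW] := oW s Ks x Wx sx.
exists (Num.min e d); first by rewrite lt_min e0 d0.
move=> y sy xy; split; [apply: eU|apply: dW] => // v /xy.
  by rewrite lt_min => /andP[].
by rewrite lt_min => /andP[].
Qed.

Let realization_open_bigU K (I : Type) (f : I -> set (realization K)) :
  (forall i, realization_open (f i)) -> realization_open (\bigcup_i f i).
Proof.
move=> of_ s Ks x [i _ fix_] sx; have [e e0 ef] := of_ i s Ks x fix_ sx.
by exists e => // y sy xy; exists i => //; exact: ef.
Qed.

HB.instance Definition _ K := isOpenTopological.Build (realization K)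
  (@realization_openT K) (@realization_openI K) (@realization_open_bigU K).

Lemma realization_openE K (U : set (realization K)) :
  open U = realization_open U.
Proof. by []. Qed.

Definition realization_incl K L (KL : simplex K `<=` simplex L) (x : realization K) :
    realization L :=
  Realization (coord_ge0 x) (KL _ (coord_simplex x)) (coord_sum1 x).

Lemma realization_eqP K (x y : realization K) :
  x = y <-> coord x =1 coord y.
Proof.
split=> [->//|]; case: x y => [f f0 fK f1] [g g0 gK g1] /= /funext fg.
move: f0 fK f1; rewrite fg => f0 fK f1.
by congr Realization; exact: Prop_irrelevance.
Qed.

Lemma realization_incl_continuous K L (KL : simplex K `<=` simplex L) :
  continuous (realization_incl KL).
Proof.
apply/continuousP => U; rewrite !realization_openE => oU s Ks x Ux sx.
have [e e0 eU] := oU s (KL _ Ks) _ Ux sx.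
by exists e => // y sy xy; exact: eU.
Qed.

End realization.
Arguments realization R {V} K.

Section persistence.
Context {R : realType} {k : nat}.

Definition index := 'I_k -> {nonneg R}.

Definition index_le (a b : index) := forall i, (a i)%:num <= (b i)%:num.

Lemma index_le_refl a : index_le a a.
Proof. by move=> i; exact: lexx. Qed.

Definition shift (d : {nonneg R}) (a : index) : index :=
  fun i => ((a i)%:num + d%:num)%:nng.

Lemma shift_ge d a : index_le a (shift d a).
Proof. by move=> i; rewrite /= lerDl. Qed.

Lemma shift_le d a b : index_le a b -> index_le (shift d a) (shift d b).
Proof. by move=> ab i; rewrite /= lerD2r; exact: ab. Qed.

Lemma shift2_ge d a : index_le a (shift d (shift d a)).
Proof. by move=> i; exact: le_trans (shift_ge d a i) (shift_ge d _ i). Qed.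

End persistence.
Arguments index R k : clear implicits.

Record pfunctor (R : realType) (k : nat) := PFunctor {
  pf_ob :> index R k -> topologicalType ;
  pf_map : forall a b, index_le a b -> pf_ob a -> pf_ob b ;
  pf_map_continuous : forall a b (ab : index_le a b), continuous (pf_map ab) ;
  pf_map_id : forall a (aa : index_le a a) x, pf_map aa x = x ;
  pf_map_comp : forall a b c (ab : index_le a b) (bc : index_le b c)
    (ac : index_le a c) x, pf_map bc (pf_map ab x) = pf_map ac x }.

Section interleaving.
Context {R : realType} {k : nat}.
Implicit Types M N : pfunctor R k.

Record nat_trans M N := NatTrans {
  nt_fun :> forall a, M a -> N a ;
  nt_continuous : forall a, continuous (@nt_fun a) ;
  nt_natural : forall a b (ab : index_le a b) x,
    nt_fun (pf_map ab x) = pf_map ab (nt_fun x) }.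

Definition pshift (d : {nonneg R}) M : pfunctor R k :=
  @PFunctor R k (fun a => M (shift d a))
    (fun a b ab => pf_map (shift_le d ab))
    (fun a b ab => @pf_map_continuous _ _ M _ _ (shift_le d ab))
    (fun a aa => @pf_map_id _ _ M _ (shift_le d aa))
    (fun a b c ab bc ac =>
       @pf_map_comp _ _ M _ _ _
         (shift_le d ab) (shift_le d bc) (shift_le d ac)).

Definition interleaved (d : {nonneg R}) M N :=
  exists (f : nat_trans M (pshift d N)) (g : nat_trans N (pshift d M)),
    (forall a (x : M a), g (shift d a) (f a x) = pf_map (shift2_ge d a) x) /\
    (forall a (y : N a), f (shift d a) (g a y) = pf_map (shift2_ge d a) y).

End interleaving.

Section homotopy.
Context {R : realType}.
Implicit Types S T : topologicalType.

Definition joined T (x y : T) := exists g : R -> T,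
  [/\ {within `[0, 1], continuous g}, g 0 = x & g 1 = y].

Definition pi0 T : set (set T) := range (@joined T).

Definition pi0_map S T (f : S -> T) (C : set S) : set T :=
  [set y | exists2 x, C x & joined (f x) y].

Definition cube n : set 'rV[R]_n := [set u | forall i, 0 <= u 0 i <= 1].

Definition cube_boundary n : set 'rV[R]_n :=
  [set u | @cube n u /\ exists i, u 0 i = 0 \/ u 0 i = 1].

(* Maps (I^n, boundary) -> (T, x).  A map out of the cube is represented by a
   function on the whole of R^n, whose values outside the cube are irrelevant;
   in particular [spheroid_homotopic] only depends on the values in the cube. *)
Definition spheroid n T (x : T) : set ('rV[R]_n -> T) :=
  [set a | {within @cube n, continuous a} /\
           forall u, cube_boundary u -> a u = x].

Definition spheroid_homotopic n T (x : T) (a b : 'rV[R]_n -> T) :=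
  exists H : R * 'rV[R]_n -> T,
    [/\ {within `[0, 1] `*` @cube n, continuous H},
        forall u, cube u -> H (0, u) = a u,
        forall u, cube u -> H (1, u) = b u &
        forall s u, 0 <= s <= 1 -> cube_boundary u -> H (s, u) = x].

Definition spheroid_class n T (x : T) (a : 'rV[R]_n -> T) :=
  [set b | spheroid x b /\ spheroid_homotopic x a b].

(* The underlying set of the n-th homotopy group of [T] at [x], n >= 1. *)
Definition pi_ n T (x : T) : set (set ('rV[R]_n -> T)) :=
  [set spheroid_class x a | a in spheroid x].

Definition pi_map n S T (f : S -> T) (x : S) (C : set ('rV[R]_n -> S)) :
    set ('rV[R]_n -> T) :=
  [set b | exists2 a, C a & spheroid_class (f x) (f \o a) b].

(* The induced maps on homotopy groups are always group morphisms, hence they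
   are isomorphisms as soon as they are bijective. *)
Definition weak_equivalence S T (f : S -> T) :=
  [/\ continuous f,
      set_bij (@pi0 S) (@pi0 T) (pi0_map f) &
      forall n (x : S), (0 < n)%N ->
        set_bij (@pi_ n S x) (@pi_ n T (f x)) (pi_map f x)].

End homotopy.
Arguments weak_equivalence R {S T} f.

Section homotopy_interleaving.
Context {R : realType} {k : nat}.
Implicit Types M N : pfunctor R k.

(* Weak equivalence of functors is the existence of a zigzag, i.e. the
   equivalence relation generated by objectwise weak equivalences. *)
Definition weakly_equivalent : pfunctor R k -> pfunctor R k -> Prop :=
  clos_refl_sym_trans _ (fun M N => exists f : nat_trans M N,
    forall a, weak_equivalence R (f a)).

Definition homotopy_interleaved (d : {nonneg R}) M N :=
  exists M' N', [/\ weakly_equivalent M M', weakly_equivalent N N' &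
                    interleaved d M' N'].

Definition d_HI M N : \bar R :=
  ereal_inf [set d%:num%:E | d in [set d | homotopy_interleaved d M N]].

End homotopy_interleaving.

Section filtration.
Context {R : realType} {k : nat} {V : choiceType}.
Variable K : index R k -> simplicial_complex V.
Hypothesis K_mono : forall a b, index_le a b -> simplex (K a) `<=` simplex (K b).

Let map_id a (aa : index_le a a) (x : realization R (K a)) :
  realization_incl (K_mono aa) x = x.
Proof. exact/realization_eqP. Qed.

Let map_comp a b c (ab : index_le a b) (bc : index_le b c) (ac : index_le a c)
    (x : realization R (K a)) :
  realization_incl (K_mono bc) (realization_incl (K_mono ab) x) =
  realization_incl (K_mono ac) x.
Proof. exact/realization_eqP. Qed.

Definition filtration_functor : pfunctor R k :=
  @PFunctor R k (fun a => realization R (K a))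
    (fun a b ab => realization_incl (K_mono ab))
    (fun a b ab => @realization_incl_continuous _ _ _ _ (K_mono ab))
    map_id map_comp.

End filtration.

Section monotonicity.
Context {R : realType}.
Implicit Types T : metricType R.

Lemma sup0_le (S S' : set (\bar R)) : S `<=` S' -> (sup0 S <= sup0 S')%E.
Proof. by move=> SS'; apply: ereal_sup_le; exact: setUS. Qed.

Lemma diam_le T (A C : set T) : A `<=` C -> (diam A <= diam C)%E.
Proof. by move=> AC; apply: sup0_le; apply: image_subset; exact: setSX. Qed.

Lemma rad_le T (A C : set T) : A `<=` C -> (rad A <= rad C)%E.
Proof.
move=> AC; apply: le_ereal_inf_tmp => _ [b _ <-].
apply: (@le_trans _ _ (sup0 [set (mdist b c)%:E | c in A])).
  by apply: ereal_inf_lbound; exists b.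
by apply: sup0_le; exact: image_subset.
Qed.

End monotonicity.

Section vietoris_rips.
Context {R : realType} {B : metricType R}.

Section bifiltration.
Variable X : bField B.

Definition VR2_simplex (r s : R) : set (set X) :=
  [set A | [/\ finite_set A, A !=set0, (diam A <= r%:E)%E &
               (rad (@bf_proj _ _ X @` A) <= (s / 2)%:E)%E]].

Let VR2_face r s A C :
  VR2_simplex r s A -> C `<=` A -> C !=set0 -> VR2_simplex r s C.
Proof.
move=> [fA A0 dA rA] CA C0; split=> //; first exact: sub_finite_set fA.
  exact: le_trans (diam_le CA) dA.
by apply: le_trans rA; apply: rad_le; exact: image_subset.
Qed.

Definition VR2_complex (r s : R) : simplicial_complex X :=
  @SimplicialComplex X (VR2_simplex r s)
    (fun A h => let: And4 fA _ _ _ := h in fA)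
    (fun A h => let: And4 _ A0 _ _ := h in A0)
    (@VR2_face r s).

Let VR2_mono (a b : index R 2) : index_le a b ->
  simplex (VR2_complex (a 0)%:num (a 1)%:num) `<=`
  simplex (VR2_complex (b 0)%:num (b 1)%:num).
Proof.
move=> ab A [fA A0 dA rA]; split=> //.
  by apply: le_trans dA _; rewrite lee_fin.
by apply: le_trans rA _; rewrite lee_fin ler_pM2r.
Qed.

Definition VR2 : pfunctor R 2 := filtration_functor VR2_mono.

End bifiltration.

Section trifiltration.
Variable X : mmField B.

Definition VR3_simplex (r s t : R) : set (set (set X)) :=
  [set S | [/\ finite_set S, S !=set0,
    forall A C, S A -> S C -> A `<=` C \/ C `<=` A &
    forall A, S A -> [/\ borel A, (diam A <= r%:E)%E,
      (rad (@bf_proj _ _ X @` A) <= (s / 2)%:E)%E &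
      ((1 - t)%:E <= mm_measure X A)%E]]].

Let VR3_face r s t S S' :
  VR3_simplex r s t S -> S' `<=` S -> S' !=set0 -> VR3_simplex r s t S'.
Proof.
move=> [fS S0 cS hS] S'S S'0; split=> //; first exact: sub_finite_set fS.
  by move=> A C /S'S SA /S'S SC; exact: cS.
by move=> A /S'S; exact: hS.
Qed.

Definition VR3_complex (r s t : R) : simplicial_complex (set X) :=
  @SimplicialComplex (set X) (VR3_simplex r s t)
    (fun A h => let: And4 fA _ _ _ := h in fA)
    (fun A h => let: And4 _ A0 _ _ := h in A0)
    (@VR3_face r s t).

Let VR3_mono (a b : index R 3) : index_le a b ->
  simplex (VR3_complex (a 0)%:num (a 1)%:num (a 2)%:num) `<=`
  simplex (VR3_complex (b 0)%:num (b 1)%:num (b 2)%:num).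
Proof.
move=> ab S [fS S0 cS hS]; split=> // A /hS [bA dA rA mA]; split=> //.
- by apply: le_trans dA _; rewrite lee_fin.
- by apply: le_trans rA _; rewrite lee_fin ler_pM2r.
- by apply: le_trans _ mA; rewrite lee_fin lerB.
Qed.

Definition VR3 : pfunctor R 3 := filtration_functor VR3_mono.

End trifiltration.

End vietoris_rips.

(* Main.v *)
From Pilot Require Import Defs.
From mathcomp Require Import all_boot all_order all_algebra.
From mathcomp Require Import finmap.
From mathcomp Require Import all_classical all_reals all_analysis.
From mathcomp Require Import ring lra.
(* So that [coord] is the barycentric coordinate, not that of a vector space. *)
Import Pilot.Defs.

(** Both bounds come from the same device: over a common space [Z] and a real
[e] witnessing that the two distances are small, each filtration is replaced by
a weakly equivalent filtration of complexes on one and the same vertex set, in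
such a way that the two replacements include into one another after a shift by
[2 * e].  The interleaving is then given by inclusions, whose composites are
literally the structure maps ([inclusion_interleaved]); all the homotopy theory
is in the comparison of a filtration with its replacement.

For the Gromov-Hausdorff distance, the vertices are the pairs [(x, y)] whose
images in [Z] are at distance less than [e], and a set of pairs is a simplex
when its first (respectively second) projection is one.

For the Gromov-Prokhorov distance, the Borel subsets of [X] and [Y] are first
traded for subsets of [Z].  Thickening by [e] is then a map between the two
families of subsets of [Z], but thickening twice only contains the identity.
This lax interleaving is made strict by a Grothendieck construction: the
vertices are pairs [(b, A)], with [b] telling which of the two fields [A] comes
from, and [(b, A) <= (c, C)] when [A], thickened if [b] and [c] differ, is
contained in [C] ([joint_complex]).  Transitivity of this relation is exactly
the laxness of the interleaving.  The complex attached to [X] allows the sets of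
[X] at their own time and those of [Y] only [2 * e] later, so that the thickened
sets of [Y] live in the complex of [X]; thickening them retracts the joint
complex onto the subcomplex of [X].

In each comparison a vertex map [p] has a section [sec], and one must see that
[p] induces a weak equivalence.  If [v <= sec (p v)] for a preorder whose
chains are the simplices, the mass of a point of the realization can be moved
from each [v] to [sec (p v)], the greatest vertices of its chain going first, so
that the unmoved and the moved vertices always form a chain; this gives a
homotopy [sweep] from the identity to the retraction induced by [sec \o p].
The pairs [(x, y)] are handled by the preorder that relates everything.  This
homotopy is piecewise linear on each cell, hence continuous by
[cell_lipschitz_continuous], and it does not change the image under [p].  Such a
fibrewise deformation moves base points, but only inside a fibre, so that the
map induced by [p] is bijective on [pi0] and on all [pi_ n]
([fibrewise_retraction_weak_equivalence]). *)

Set Implicit Arguments.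
Unset Strict Implicit.
Unset Printing Implicit Defensive.

Import Order.TTheory GRing.Theory Num.Theory.
Import numFieldNormedType.Exports.

Local Open Scope classical_set_scope.
Local Open Scope ring_scope.

(** * Finitely supported masses and simplicial maps *)

Section mass_image.
Context {R : realType}.
Implicit Types V W U : choiceType.

Lemma finite_set_uniq_seq V (s : set V) : finite_set s ->
  exists2 r : seq V, uniq r & s = [set` r].
Proof.
move=> /finite_seqP[r ->]; exists (undup r); first exact: undup_uniq.
by apply/seteqP; split=> v /=; rewrite mem_undup.
Qed.

Definition supp V (c : V -> R) : set V := [set v | c v != 0].

Lemma fsumT_seq V (c : V -> R) (r : seq V) : uniq r -> supp c `<=` [set` r] ->
  \sum_(v \in [set: V]) c v = \sum_(v <- r) c v.
Proof.
move=> ur cr; rewrite [RHS]fsbig_seq//; apply/esym; apply: fsbig_widen => //.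
by move=> v [_ /= vr]; apply: contra_notP vr => /eqP /cr.
Qed.

(** The push-forward of a finitely supported measure, given by point masses. *)
Definition mass_image V W (p : V -> W) (c : V -> R) (w : W) : R :=
  \sum_(v \in [set: V]) c v * (p v == w)%:R.

Lemma mass_image_seq V W (p : V -> W) c (r : seq V) w :
  uniq r -> supp c `<=` [set` r] ->
  mass_image p c w = \sum_(v <- r) c v * (p v == w)%:R.
Proof.
move=> ur cr; apply: fsumT_seq => // v /=; apply: contra_neqP => /= vr.
have -> : c v = 0 by apply: contra_notP vr => /eqP /cr.
by rewrite mul0r.
Qed.

Lemma mass_image_ge0 V W (p : V -> W) c w : (forall v, 0 <= c v) ->
  0 <= mass_image p c w.
Proof. by move=> c0; apply: fsumr_ge0 => v _; rewrite mulr_ge0. Qed.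

Lemma supp_mass_image V W (p : V -> W) c :
  supp (mass_image p c) `<=` p @` supp c.
Proof.
move=> w; apply: contraPP => /= nw; apply/negP; rewrite negbK; apply/eqP.
apply: fsbig1 => v _; have [pv|_] := eqVneq (p v) w; last by rewrite mulr0.
rewrite mulr1; apply: contra_notP nw => /eqP cv; exists v => //.
Qed.

Lemma sum_mass_image V W (p : V -> W) c : finite_set (supp c) ->
  \sum_(w \in [set: W]) mass_image p c w = \sum_(v \in [set: V]) c v.
Proof.
move=> /finite_set_uniq_seq[r ur cr].
have cr' : supp c `<=` [set` r] by rewrite cr.
pose q := undup (map p r).
rewrite (@fsumT_seq _ _ q) ?undup_uniq//; last first.
  move=> w /supp_mass_image[v cv <-] /=.
  by rewrite mem_undup map_f//; exact: cr'.
rewrite (fsumT_seq ur)//.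
under eq_bigr do rewrite (mass_image_seq _ _ ur)//.
rewrite exchange_big/=; apply: eq_big_seq => v vr.
rewrite -mulr_sumr (bigD1_seq (p v)) ?undup_uniq ?mem_undup ?map_f//=.
rewrite eqxx big1 ?addr0 ?mulr1// => w wp.
by rewrite eq_sym (negbTE wp).
Qed.

Lemma mass_image_comp V W U (p : V -> W) (q : W -> U) c :
  finite_set (supp c) ->
  mass_image q (mass_image p c) =1 mass_image (q \o p) c.
Proof.
move=> /finite_set_uniq_seq[r ur cr] u.
have cr' : supp c `<=` [set` r] by rewrite cr.
rewrite (mass_image_seq _ _ ur)//.
rewrite (@mass_image_seq _ _ q _ (undup (map p r))) ?undup_uniq//; last first.
  move=> w /supp_mass_image[v cv <-] /=.
  by rewrite mem_undup map_f//; exact: cr'.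
under eq_bigr do rewrite (mass_image_seq _ _ ur)// mulr_suml.
rewrite exchange_big/=; apply: eq_big_seq => v vr.
rewrite (bigD1_seq (p v)) ?undup_uniq ?mem_undup ?map_f//=.
rewrite eqxx big1 ?addr0 ?mulr1// => w wp.
by rewrite eq_sym (negbTE wp) mulr0 mul0r.
Qed.

Lemma mass_image_id V (p : V -> V) c : p =1 id -> finite_set (supp c) ->
  mass_image p c =1 c.
Proof.
move=> pid /finite_set_uniq_seq[r ur cr] u.
have cr' : supp c `<=` [set` r] by rewrite cr.
rewrite (mass_image_seq _ _ ur)//.
have [ru|ru] := boolP (u \in r).
  rewrite (bigD1_seq u)//= pid eqxx mulr1 big1 ?addr0// => v vu.
  by rewrite pid (negbTE vu) mulr0.
rewrite big1_seq; last first.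
  move=> v /andP[_ rv]; rewrite pid; case: eqVneq => [vu|]; rewrite ?mulr0//.
  by rewrite -vu rv in ru.
by apply/esym; apply: contraNP ru => /eqP /cr'.
Qed.

Lemma mass_image_lin V W (p : V -> W) c1 c2 c3 r :
  uniq r -> supp c1 `<=` [set` r] -> supp c2 `<=` [set` r] ->
  supp c3 `<=` [set` r] ->
  mass_image p (fun v => c1 v - c2 v + c3 v) =1
  (fun w => mass_image p c1 w - mass_image p c2 w + mass_image p c3 w).
Proof.
move=> ur c1r c2r c3r w; rewrite !(mass_image_seq _ _ ur)//; last first.
  move=> v; apply: contraPP => vr; rewrite /supp/=.
  have /eqP -> : c1 v == 0 by apply: contra_notT vr => /c1r.
  have /eqP -> : c2 v == 0 by apply: contra_notT vr => /c2r.
  have /eqP -> : c3 v == 0 by apply: contra_notT vr => /c3r.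
  by rewrite subrr addr0 eqxx.
rewrite -sumrB -big_split/=; apply: eq_bigr => v _; ring.
Qed.

End mass_image.

Section realization_maps.
Context {R : realType}.
Implicit Types V W : choiceType.

Lemma supp_finite V (K : simplicial_complex V) (x : realization R K) :
  finite_set (supp (coord x)).
Proof. exact: simplex_finite (coord_simplex x). Qed.

Lemma simplex_supp V (K : simplicial_complex V) (c : V -> R) (s : set V) :
  simplex K s -> supp c `<=` s -> \sum_(v \in [set: V]) c v = 1 ->
  simplex K (supp c).
Proof.
move=> Ks cs c1; apply: simplex_face Ks cs _.
apply: contrapT => /set0P/negP; rewrite negbK => /eqP c0.
move: c1; rewrite fsbig1; first by move/eqP; rewrite eq_sym oner_eq0.
move=> v _; apply: contrapT => /eqP cv.
by have : supp c v by []; rewrite c0.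
Qed.

Definition simplicial V W (K : simplicial_complex V) (L : simplicial_complex W)
  (p : V -> W) := forall s, simplex K s -> simplex L (p @` s).

Section simplicial_map.
Variables (V W : choiceType) (K : simplicial_complex V)
  (L : simplicial_complex W) (p : V -> W).
Hypothesis Kp : simplicial K L p.

Lemma simplicial_map_sum (x : realization R K) :
  \sum_(w \in [set: W]) mass_image p (coord x) w = 1.
Proof. by rewrite sum_mass_image; [exact: coord_sum1|exact: supp_finite]. Qed.

Definition simplicial_map (x : realization R K) : realization R L :=
  Realization (fun w => mass_image_ge0 p w (coord_ge0 x))
    (simplex_supp (Kp (coord_simplex x)) (@supp_mass_image _ _ _ p (coord x))
       (simplicial_map_sum x))
    (simplicial_map_sum x).

End simplicial_map.
End realization_maps.

(** * Continuity of homotopies of realizations *)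

Section realization_topology.
Context {R : realType}.
Implicit Types V W : choiceType.

Lemma near_right_small (P : R -> Prop) (e : R) : 0 < e ->
  (forall d, 0 < d -> d < e -> P d) -> \forall d \near 0^'+, P d.
Proof.
move=> e0 eP; near=> d; apply: eP; first by near: d; exact: nbhs_right_gt.
by near: d; exact: nbhs_right_lt.
Unshelve. all: by end_near. Qed.

Lemma near_right_ex (P : R -> Prop) : (\forall d \near 0^'+, P d) ->
  exists2 d, 0 < d & P d.
Proof.
move=> nP; near (0 : R)^'+ => d; exists d; first by near: d; exact: nbhs_right_gt.
by near: d.
Unshelve. all: by end_near. Qed.

(** The topology of the realization is defined by its traces on closed cells;
  this extends it to the union of all cells with vertices in a finite set [D],
  which need not be a simplex. *)
Lemma open_finite_trace V (K : simplicial_complex V) (U : set (realization R K))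
    (D : set V) (x : realization R K) :
  open U -> finite_set D -> U x ->
  \forall e \near 0^'+, forall y : realization R K, supp (coord y) `<=` D ->
    (forall v, `|coord x v - coord y v| < e) -> U y.
Proof.
rewrite realization_openE => oU fD Ux.
pose good (u : {fset V}) (e : R) := forall y : realization R K,
  supp (coord y) = [set` u] ->
  (forall v, `|coord x v - coord y v| < e) -> U y.
suff : \forall e \near 0^'+,
    (\bigcap_(u in [set` fpowerset (fset_set D)]) good u) e.
  apply: filterS => e De y yD xy.
  have fy := supp_finite y.
  apply: (De (fset_set (supp (coord y)))) => //; last first.
    by apply/seteqP; split=> v /=; rewrite in_fset_set ?inE.
  by rewrite /= fpowersetE -fset_set_sub.
apply: filter_bigI => u uD.
have [xu|xu] := pselect (supp (coord x) `<=` [set` u]).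
  have [Ku|Ku] := pselect (simplex K [set` u]); last first.
    apply: (near_right_small ltr01) => d _ _ y yu.
    by exfalso; apply: Ku; rewrite -yu; exact: coord_simplex.
  have [e e0 eU] := oU _ Ku _ Ux xu.
  apply: (near_right_small e0) => d _ de y yu xy; apply: eU => [|v _].
    by rewrite /closed_cell /= -yu.
  exact: lt_trans (xy v) de.
(* Cells that do not contain [x] stay away from it, in the coordinate of any
   vertex of the support of [x] that they miss. *)
have [v /= vx vu] : exists2 v, supp (coord x) v & ~ [set` u] v.
  by apply: contrapT => h; apply: xu => v xv; apply: contrapT => uv; apply: h; exists v.
have xv0 : 0 < `|coord x v| by rewrite normr_gt0.
apply: (near_right_small xv0) => d _ dx y yu /(_ v).
have -> : coord y v = 0.
  by apply: contra_notP vu => /eqP yv; have : supp (coord y) v by []; rewrite yu.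
by rewrite subr0 ltNge (ltW dx).
Qed.

(** The set [D] is not required to be a simplex, since a homotopy may drag one
  cell through several others. *)
Definition cell_lipschitz V W (K : simplicial_complex V)
    (L : simplicial_complex W) (H : realization R K -> R -> realization R L)
    (s : set V) :=
  exists2 D : set W, finite_set D & exists2 C : R, 0 < C &
    forall (x y : realization R K) (t t' d : R),
      closed_cell s x -> closed_cell s y -> `|t - t'| <= d ->
      (forall v, `|coord x v - coord y v| <= d) ->
      supp (coord (H x t)) `<=` D /\
      forall w, `|coord (H x t) w - coord (H y t') w| <= C * d.

(** The cellwise topology is not obviously compatible with the product by the
  real line.  The tube lemma settles this: if [H x0] maps a compact interval
  around [t0] into an open set, then so do all [H x] with [x] in a set that is
  open on each cell. *)
Lemma cell_lipschitz_continuous V W (K : simplicial_complex V)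
    (L : simplicial_complex W) (H : realization R K -> R -> realization R L) :
  (forall s, simplex K s -> cell_lipschitz H s) ->
  continuous (fun z : realization R K * R => H z.1 z.2).
Proof.
move=> lipH; apply/continuousP => U oU; rewrite openE => -[x0 t0] /= Ux0.
have near_cell s (x : realization R K) t :
    simplex K s -> closed_cell s x -> U (H x t) ->
    \forall e \near 0^'+, forall y t', closed_cell s y -> `|t - t'| < e ->
      (forall v, `|coord x v - coord y v| < e) -> U (H y t').
  move=> Ks sx Ux; have [D fD [C C0 HC]] := lipH s Ks.
  have sD y t' : closed_cell s y -> supp (coord (H y t')) `<=` D.
    move=> sy; have dd (a : R) : `|a - a| <= 0 by rewrite subrr normr0.
    by have [] := HC y y t' t' 0 sy sy (dd _) (fun v => dd _).
  have [e e0 eU] := near_right_ex (open_finite_trace oU fD Ux).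
  apply: (@near_right_small _ (e / C)); first by rewrite divr_gt0.
  move=> d d0; rewrite ltr_pdivlMr// => dC y t' sy tt' xy.
  have [_ Hxy] := HC x y t t' d sx sy (ltW tt') (fun v => ltW (xy v)).
  apply: eU => [|v]; first exact: sD.
  by apply: le_lt_trans (Hxy v) _; rewrite mulrC.
have [e e0 eU] : exists2 e, 0 < e & forall t, `|t0 - t| <= e -> U (H x0 t).
  have [e e0 eU] := near_right_ex
    (near_cell _ x0 t0 (coord_simplex x0) (@subset_refl _ _) Ux0).
  exists (e / 2); first by rewrite divr_gt0.
  move=> t tt0; apply: eU => //.
    by apply: le_lt_trans tt0 _; rewrite ltr_pdivrMr// ltr_pMr// ltr1n.
  by move=> v; rewrite subrr normr0.
pose J := `[t0 - e, t0 + e]%classic.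
pose W0 := [set x : realization R K | forall t, J t -> U (H x t)].
have oW : open W0.
  rewrite realization_openE => s Ks x Wx sx.
  have : \forall d \near 0^'+, J `<=` [set t | forall y, closed_cell s y ->
      (forall v, `|coord x v - coord y v| < d) -> U (H y t)].
    (* One radius [d] serves all times of the compact interval [J]. *)
    have /compact_near_coveringP/near_covering_withinP := @segment_compact R (t0 - e) (t0 + e).
    apply => t Jt.
    have [d d0 dU] := near_right_ex (near_cell s x t Ks sx (Wx t Jt)).
    exists (ball t d, [set d' | 0 < d' < d]) => /=.
      split; first exact: nbhsx_ballx.
      by apply: (near_right_small d0) => d' d'0 d'd; apply/andP.
    move=> [t' d'] /= [tt' /andP[d'0 dd']] _ y sy xy; apply: dU => // v.
    exact: lt_trans (xy v) dd'.
  move=> /near_right_ex[d d0 dU]; exists d => // y sy xy t Jt.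
  apply: dU => // v; have [/xy//|sv] := pselect (s v).
  have x0v : coord x v = 0 by apply: contra_notP sv => /eqP /sx.
  have y0v : coord y v = 0 by apply: contra_notP sv => /eqP /sy.
  by rewrite x0v y0v subrr normr0.
exists (W0, ball t0 e).
  split=> /=.
    apply: open_nbhs_nbhs; split=> // t Jt; apply: eU.
    by move: Jt; rewrite /J /= in_itv/= ler_distlC.
  exact: nbhsx_ballx.
move=> [x t] /= [Wx te]; apply: Wx; rewrite /J /= in_itv/= -ler_distlC.
exact: ltW.
Qed.
End realization_topology.

(** * Sweeping the mass of a chain upwards *)

Section lipschitz_maps.
Context {R : realType}.
Implicit Types V W : choiceType.

Lemma ler_norm_sum_seq V (r : seq V) (f : V -> R) (d : R) :
  (forall v, `|f v| <= d) -> `|\sum_(v <- r) f v| <= (size r)%:R * d.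
Proof.
move=> fd; apply: le_trans (ler_norm_sum _ _ _) _.
elim: r => [|v r IH]; first by rewrite big_nil mul0r.
by rewrite big_cons -natr1 mulrDl mul1r addrC lerD.
Qed.

Lemma sum_mask_lipschitz V (r : seq V) (b : pred V) (c c' : V -> R) (d : R) :
  (forall v, `|c v - c' v| <= d) ->
  `|\sum_(v <- r) c v * (b v)%:R - \sum_(v <- r) c' v * (b v)%:R| <=
    (size r)%:R * d.
Proof.
move=> cd; rewrite -sumrB; apply: ler_norm_sum_seq => v.
rewrite -mulrBl; case: (b v); rewrite ?mulr1// mulr0 normr0.
exact: le_trans (normr_ge0 _) (cd v).
Qed.

Lemma mass_image_lipschitz V W (p : V -> W) (r : seq V) (c c' : V -> R)
    (d : R) w :
  uniq r -> supp c `<=` [set` r] -> supp c' `<=` [set` r] ->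
  (forall v, `|c v - c' v| <= d) ->
  `|mass_image p c w - mass_image p c' w| <= (size r)%:R * d.
Proof.
move=> ur cr c'r cd; rewrite !(mass_image_seq _ _ ur)//.
exact: (sum_mask_lipschitz r (fun v => p v == w)).
Qed.

Lemma simplicial_map_continuous V W (K : simplicial_complex V)
    (L : simplicial_complex W) (p : V -> W) (Kp : simplicial K L p) :
  continuous (simplicial_map (R := R) Kp).
Proof.
pose H (x : realization R K) (_ : R) := simplicial_map Kp x.
have cH : continuous (fun z : realization R K * R => H z.1 z.2).
  apply: cell_lipschitz_continuous => s Ks.
  have fs := simplex_finite Ks.
  have [r ur sr] := finite_set_uniq_seq fs.
  exists (p @` s); first exact: finite_image.
  exists ((size r)%:R + 1); first by rewrite ltr_wpDl.
  move=> x y t t' d sx sy td xyd; split.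
    by move=> w /supp_mass_image[v vx <-]; exists v => //; exact: sx.
  move=> w; apply: (@le_trans _ _ ((size r)%:R * d)).
    by apply: mass_image_lipschitz => //; rewrite -sr.
  rewrite ler_wpM2r ?lerDl//.
  exact: le_trans (normr_ge0 _) td.
move=> x; apply: (continuous_comp (f := fun x => (x, 0 : R))
  (g := fun z => H z.1 z.2)); last exact: cH.
exact: (cvg_pair (F := nbhs x) (f := id) (g := fun=> 0) cvg_id (cvg_cst _)).
Qed.

End lipschitz_maps.

(** Two cases are intended: [le] is a preorder whose chains are the simplices and
  [phi] is an order-preserving map above the identity, or [le] relates
  everything and [phi] moves the vertices of a simplex within a larger one. *)
Section sweep.
Context {R : realType} {V : choiceType} (K : simplicial_complex V).
Variables (le : V -> V -> Prop) (phi : V -> V).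
Hypothesis le_tr : forall u v w, le u v -> le v w -> le u w.
Hypothesis le_tot : forall s, simplex K s ->
  forall v w, s v -> s w -> le v w \/ le w v.
Hypothesis phi_simplex : forall s u w, simplex K s -> u `<=` s -> w `<=` s ->
  (forall v v', u v -> w v' -> le v v') -> u `|` phi @` w !=set0 ->
  simplex K (u `|` phi @` w).
Implicit Types x y : realization R K.

Let slt v w : bool := `[< le v w /\ ~ le w v >].

Definition mass_above (c : V -> R) (v : V) : R :=
  \sum_(w \in [set: V]) c w * (slt v w)%:R.

(** The mass that has left [v] at time [t].  Each vertex waits until the mass
  strictly above it has gone, then gives up its own at unit speed; equivalent
  vertices of the preorder move together. *)
Definition moved (c : V -> R) (t : R) (v : V) : R :=
  Num.max 0 (Num.min (t - mass_above c v) (c v)).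

Definition sweep_coord (c : V -> R) (t : R) (v : V) : R :=
  c v - moved c t v + mass_image phi (moved c t) v.

Lemma mass_above_seq c v r : uniq r -> supp c `<=` [set` r] ->
  mass_above c v = \sum_(w <- r) c w * (slt v w)%:R.
Proof.
move=> ur cr; apply: fsumT_seq => // w; apply: contraPP => /= wr; apply/negP.
have -> : c w = 0 by apply: contra_notP wr => /eqP /cr.
by rewrite mul0r eqxx.
Qed.

Section coordinates.
Variable x : realization R K.
Let c := coord x.

Lemma mass_above_ge0 v : 0 <= mass_above c v.
Proof. by apply: fsumr_ge0 => w _; rewrite mulr_ge0// coord_ge0. Qed.

Lemma moved_ge0 t v : 0 <= moved c t v.
Proof. by rewrite le_max lexx. Qed.

Lemma moved_le t v : moved c t v <= c v.
Proof. by rewrite ge_max coord_ge0 ge_min lexx orbT. Qed.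

Lemma supp_moved t : supp (moved c t) `<=` supp c.
Proof.
move=> v; rewrite /supp/=; apply: contraNN => /eqP cv0.
by rewrite eq_le moved_ge0 andbT -cv0 moved_le.
Qed.

Lemma moved0 v : moved c 0 v = 0.
Proof.
by apply/max_idPl; rewrite ge_min sub0r oppr_le0 mass_above_ge0.
Qed.

(** Every vertex has given up all its mass at time 1. *)
Lemma mass_above_self v : c v + mass_above c v <= 1.
Proof.
have [r ur cr] := finite_set_uniq_seq (supp_finite x).
have cr' : supp c `<=` [set` r] by rewrite -cr.
rewrite -(coord_sum1 x) (fsumT_seq ur)// (mass_above_seq v ur)//.
have [vr|vr] := boolP (v \in r); last first.
  have -> : c v = 0 by apply: contraNP vr => /eqP /cr'.
  rewrite add0r; apply: ler_sum => w _.
  by rewrite -[leRHS]mulr1 ler_wpM2l ?coord_ge0// lern1; case: slt.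
rewrite (bigD1_seq v)//= [leRHS](bigD1_seq v)//= lerD2l.
have -> : slt v v = false by apply/asboolP => -[].
rewrite mulr0 add0r; apply: ler_sum => w _.
by rewrite -[leRHS]mulr1 ler_wpM2l ?coord_ge0// lern1; case: slt.
Qed.

Lemma moved1 v : moved c 1 v = c v.
Proof.
rewrite /moved min_r ?lerBrDr ?mass_above_self//.
by apply/max_idPr; exact: coord_ge0.
Qed.

Lemma mass_above_lt v v' : le v' v -> ~ le v v' ->
  c v + mass_above c v <= mass_above c v'.
Proof.
move=> v'v nvv'; have [r ur cr] := finite_set_uniq_seq (supp_finite x).
have cr' : supp c `<=` [set` r] by rewrite -cr.
have sub w : slt v w -> slt v' w.
  move=> /asboolP[vw nwv]; apply/asboolP; split; first exact: le_tr vw.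
  by move=> wv'; apply: nwv; exact: le_tr v'v.
have sum_le (P : pred V) : \sum_(w <- r | P w) c w * (slt v w)%:R <=
    \sum_(w <- r | P w) c w * (slt v' w)%:R.
  apply: ler_sum => w _; rewrite ler_wpM2l ?coord_ge0// ler_nat.
  by have := sub w; case: (slt v w) => // ->.
rewrite !(mass_above_seq _ ur)//.
have [vr|vr] := boolP (v \in r); last first.
  have -> : c v = 0 by apply: contraNP vr => /eqP /cr'.
  by rewrite add0r.
rewrite (bigD1_seq v)//= [leRHS](bigD1_seq v)//=.
have -> : slt v v = false by apply/asboolP => -[].
have -> : slt v' v by apply/asboolP.
by rewrite mulr0 add0r mulr1 lerD2l.
Qed.

Lemma sweep_coord_ge0 t v : 0 <= sweep_coord c t v.
Proof.
rewrite addr_ge0 ?subr_ge0 ?moved_le//.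
exact/mass_image_ge0/moved_ge0.
Qed.

Lemma supp_sweep t : supp (sweep_coord c t) `<=`
  [set v | moved c t v < c v] `|` phi @` [set v | 0 < moved c t v].
Proof.
move=> v; apply: contraPP => /not_orP[/= /negP + nw]; rewrite -leNgt => cm.
rewrite /supp /=.
have -> : sweep_coord c t v = mass_image phi (moved c t) v.
  rewrite /sweep_coord (_ : moved c t v = c v) ?subrr ?add0r//.
  by apply/eqP; rewrite eq_le moved_le.
move=> pv; have [w mw wv] := @supp_mass_image _ _ _ phi _ v pv.
apply: nw; exists w => //=.
by rewrite lt_neqAle eq_sym moved_ge0 andbT.
Qed.

Lemma supp_moved_finite t : finite_set (supp (moved c t)).
Proof. by apply: sub_finite_set (supp_finite x); exact: supp_moved. Qed.

Lemma sweep_seq t : exists2 r : seq V, uniq r &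
  [/\ supp c `<=` [set` r], supp (moved c t) `<=` [set` r] &
      supp (mass_image phi (moved c t)) `<=` [set` r]].
Proof.
have [r ur rE] : exists2 r, uniq r &
    supp c `|` supp (mass_image phi (moved c t)) = [set` r].
  apply: finite_set_uniq_seq; rewrite finite_setU; split; first exact: supp_finite.
  apply: sub_finite_set (finite_image phi (supp_moved_finite t)).
  exact: supp_mass_image.
have rc : supp c `<=` [set` r] by rewrite -rE; exact: subsetUl.
exists r => //; split=> //; last by rewrite -rE; exact: subsetUr.
exact: subset_trans (@supp_moved t) rc.
Qed.

Lemma sweep_sum t : \sum_(v \in [set: V]) sweep_coord c t v = 1.
Proof.
have [r ur [rc rm rp]] := sweep_seq t.
rewrite (fsumT_seq ur); last first.
  move=> v; rewrite {1}/supp/=; apply: contraPP => vr; apply/negP; rewrite negbK.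
  have cv0 : c v = 0 by apply: contra_notP vr => /eqP /rc.
  have mv0 : moved c t v = 0 by apply: contra_notP vr => /eqP /rm.
  have pv0 : mass_image phi (moved c t) v = 0.
    by apply: contra_notP vr => /eqP /rp.
  by rewrite /sweep_coord cv0 mv0 pv0 subrr addr0.
rewrite big_split sumrB/= -(fsumT_seq ur rc) -(fsumT_seq ur rm) -(fsumT_seq ur rp).
by rewrite sum_mass_image ?subrK ?coord_sum1//; exact: supp_moved_finite.
Qed.

(** If some mass has left [v'] while some is left at [v], then [v] is not
  strictly above [v']: otherwise [v] would have been emptied first, by
  [mass_above_lt].  Hence [v] is below [v'] in their common simplex, and
  [phi_simplex] applies to the vertices still occupied and the vertices
  already left. *)
Lemma sweep_simplex t : simplex K (supp (sweep_coord c t)).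
Proof.
set u := [set v | moved c t v < c v]; set w := [set v | 0 < moved c t v].
suff : simplex K (u `|` phi @` w).
  by move/simplex_supp; apply; [exact: supp_sweep|exact: sweep_sum].
have us : u `<=` supp c.
  by move=> v /= mv; rewrite /supp/= gt_eqF//; apply: le_lt_trans mv; exact: moved_ge0.
have ws : w `<=` supp c.
  by move=> v /= mv; apply: (@supp_moved t); rewrite /supp/= gt_eqF.
apply: (phi_simplex (coord_simplex x)) => //.
  move=> v v' uv wv'; have [//|v'v] := le_tot (coord_simplex x) (us _ uv) (ws _ wv').
  apply: contrapT => nvv'; have := mass_above_lt v'v nvv'.
  move: uv wv'; rewrite /u /w /= /moved.
  rewrite gt_max lt_max ltxx/= gt_min lt_min ltxx orbF => /andP[_ tv].
  move=> /andP[tv' _]; lra.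
apply: contrapT => /set0P/negP; rewrite negbK => /eqP e0.
have := sweep_sum t; rewrite fsbig1; first by move/eqP; rewrite eq_sym oner_eq0.
move=> v _; apply: contrapT => /eqP cv.
by have := @supp_sweep t v cv; rewrite -/u -/w e0.
Qed.

Definition sweep t : realization R K :=
  Realization (sweep_coord_ge0 t) (sweep_simplex t) (sweep_sum t).

End coordinates.

Lemma clamp_lipschitz (a b a' b' : R) :
  `|Num.max 0 (Num.min a b) - Num.max 0 (Num.min a' b')| <=
  `|a - a'| + `|b - b'|.
Proof.
have := ler_norm (a - a'); have := ler_norm (b - b').
have := ler_norm (- (a - a')); have := ler_norm (- (b - b')); rewrite !normrN.
move: `|a - a'| `|b - b'| => A B hB hA hB' hA'; rewrite ler_norml.
case: (leP a b) => ab; case: (leP a' b') => ab'.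
- by case: (leP 0 a) => a0; case: (leP 0 a') => a0'; apply/andP; split; lra.
- by case: (leP 0 a) => a0; case: (leP 0 b') => b0'; apply/andP; split; lra.
- by case: (leP 0 b) => b0; case: (leP 0 a') => a0'; apply/andP; split; lra.
- by case: (leP 0 b) => b0; case: (leP 0 b') => b0'; apply/andP; split; lra.
Qed.

Lemma sweep_continuous :
  continuous (fun z : realization R K * R => sweep z.1 z.2).
Proof.
apply: cell_lipschitz_continuous => s Ks.
have fs := simplex_finite Ks.
have [r ur sr] := finite_set_uniq_seq fs.
exists (s `|` phi @` s).
  by rewrite finite_setU; split => //; exact: finite_image.
pose N : R := (size r)%:R.
have N0 : 0 <= N by [].
(* A mass above moves by [N * d] at most, hence a moved mass by [(N + 2) * d];
   its push-forward adds up at most [N] of them. *)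
exists (1 + (N + 2) + N * (N + 2)).
  by rewrite ltr_wpDr ?mulr_ge0 ?addr_ge0// ltr_wpDr ?addr_ge0.
move=> x y t t' d sx sy td xyd; split.
  move=> v /supp_sweep[mv|[w mw <-]]; [left|right; exists w => //]; apply: sx => /=.
    by rewrite gt_eqF//; apply: le_lt_trans mv; exact: moved_ge0.
  by apply: (@supp_moved _ t); rewrite /supp /= gt_eqF.
have rx : supp (coord x) `<=` [set` r] by rewrite -sr.
have ry : supp (coord y) `<=` [set` r] by rewrite -sr.
have movedL v : `|moved (coord x) t v - moved (coord y) t' v| <= (N + 2) * d.
  apply: le_trans (clamp_lipschitz _ _ _ _) _.
  have : `|mass_above (coord x) v - mass_above (coord y) v| <= N * d.
    by rewrite !(mass_above_seq _ ur)//; exact: sum_mask_lipschitz.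
  have -> : t - mass_above (coord x) v - (t' - mass_above (coord y) v) =
    (t - t') - (mass_above (coord x) v - mass_above (coord y) v) by ring.
  have := ler_normB (t - t') (mass_above (coord x) v - mass_above (coord y) v).
  have := xyd v; lra.
move=> w; rewrite /= /sweep_coord.
have pL : `|mass_image phi (moved (coord x) t) w -
    mass_image phi (moved (coord y) t') w| <= N * ((N + 2) * d).
  apply: mass_image_lipschitz => //.
    exact: subset_trans (@supp_moved _ _) rx.
  exact: subset_trans (@supp_moved _ _) ry.
set a := mass_image _ _ _ in pL *; set b := mass_image _ _ _ in pL *.
set e := moved _ _ _; set f := moved _ _ _.
have ef : `|e - f| <= (N + 2) * d by exact: movedL.
have -> : coord x w - e + a - (coord y w - f + b) =
  (coord x w - coord y w) - (e - f) + (a - b) by ring.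
apply: le_trans (ler_normD _ _) _.
have := ler_normB (coord x w - coord y w) (e - f).
have := xyd w; lra.
Qed.

Lemma sweep0 x : sweep x 0 = x.
Proof.
apply/realization_eqP => v; rewrite /= /sweep_coord moved0 subr0.
rewrite /mass_image fsbig1 ?addr0// => w _.
by rewrite moved0 mul0r.
Qed.

Lemma sweep1 x : coord (sweep x 1) =1 mass_image phi (coord x).
Proof.
move=> v; rewrite /= /sweep_coord moved1 subrr add0r.
by apply: eq_fsbigr => w _; rewrite moved1.
Qed.

(** The sweep takes place in the fibres of any vertex map that [phi] preserves. *)
Lemma mass_image_sweep (W : choiceType) (p : V -> W) x t : p \o phi =1 p ->
  mass_image p (coord (sweep x t)) =1 mass_image p (coord x).
Proof.
move=> pphi w.
have [r ur [rc rm rp]] := sweep_seq x t.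
rewrite (mass_image_lin p ur rc rm rp w) mass_image_comp; last exact: supp_moved_finite.
have -> : p \o phi = p by apply/funext.
by rewrite subrK.
Qed.

End sweep.

(** * Paths and spheroids *)

Section topology_lemmas.
Context {R : realType}.
Implicit Types X S T : topologicalType.

(** Maps on an interval or a cube are precomposed with a retraction onto it, so
  as to work with globally continuous maps only. *)
Lemma within_continuous_retract X S T (D : set S) (r : X -> S) (f : S -> T) :
  {within D, continuous f} -> continuous r -> (forall x, D (r x)) ->
  continuous (f \o r).
Proof.
move=> /subspace_continuousP cf cr rD x.
apply: (cvg_comp r f _ (cf _ (rD x))) => A wA.
have : nbhs x (r @^-1` [set y | D y -> A y]) := cr x _ wA.
by apply: filterS => y; apply; exact: rD.
Qed.

Lemma continuous_paste X T (q : X -> R) (c : R) (f g : X -> T) :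
  continuous q -> continuous f -> continuous g ->
  (forall x, q x = c -> f x = g x) ->
  continuous (fun x => if q x <= c then f x else g x).
Proof.
move=> cq cf cg fg.
have cA : closed (q @^-1` [set y | y <= c]).
  by apply: preimage_closed => //; exact: closed_le.
have cB : closed (q @^-1` [set y | c <= y]).
  by apply: preimage_closed => //; exact: closed_ge.
have ABT : [set: X] = q @^-1` [set y | y <= c] `|` q @^-1` [set y | c <= y].
  apply/seteqP; split=> // x _ /=; exact/orP/le_total.
apply/continuous_subspace_setT; rewrite ABT; apply: withinU_continuous => //.
  apply: (subspace_eq_continuous (f := f)); last exact: continuous_subspaceT.
  by move=> x /set_mem /= xc; rewrite /from_subspace xc.
apply: (subspace_eq_continuous (f := g)); last exact: continuous_subspaceT.
move=> x /set_mem /= cx; rewrite /from_subspace; case: ifPn => // xc.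
by apply/esym/fg/eqP; rewrite eq_le xc.
Qed.

Lemma continuous_idfun X : continuous (fun x : X => x).
Proof. by move=> x; exact: cvg_id. Qed.

Lemma continuous_after X S T (g : S -> T) (f : X -> S) : continuous g ->
  continuous f -> continuous (fun x => g (f x)).
Proof. by move=> cg cf x; exact: (continuous_comp (cf x) (cg (f x))). Qed.

Lemma continuous_pair X S T (f : X -> S) (g : X -> T) :
  continuous f -> continuous g -> continuous (fun x => (f x, g x)).
Proof. move=> cf cg x; exact: (cvg_pair (F := nbhs x) (cf x) (cg x)). Qed.

Lemma continuous_rV X n (F : X -> 'rV[R]_n) :
  (forall i, continuous (fun x => F x 0 i)) -> continuous F.
Proof.
move=> cF x A [P Px PA]; rewrite /= nbhs_filterE.
have : \forall y \near x, forall i, P 0 i (F y 0 i).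
  apply: filter_forall => i; exact: (cF i x _ (Px 0 i)).
by apply: filterS => y Py; apply: PA => i j; rewrite (ord1 i).
Qed.

Definition clamp (t : R) : R := Num.max 0 (Num.min 1 t).

Lemma clamp_itv t : 0 <= clamp t <= 1.
Proof. by rewrite le_max lexx ge_max ler01 ge_min lexx. Qed.

Lemma clamp_id t : 0 <= t <= 1 -> clamp t = t.
Proof. by move=> /andP[t0 t1]; rewrite /clamp min_r// max_r. Qed.

Lemma clamp_le0 t : t <= 0 -> clamp t = 0.
Proof. by move=> t0; apply/max_idPl; rewrite ge_min t0 orbT. Qed.

Lemma clamp_ge1 t : 1 <= t -> clamp t = 1.
Proof. by move=> t1; rewrite /clamp min_l// max_r. Qed.

Lemma continuous_clamp X (f : X -> R) : continuous f ->
  continuous (fun x => clamp (f x)).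
Proof.
move=> cf x; apply: (@continuous_max R X (cst 0) (fun x => Num.min 1 (f x))).
  exact: cst_continuous.
by apply: (@continuous_min R X (cst 1) f); [exact: cst_continuous|exact: cf].
Qed.

Lemma continuous_add X (f g : X -> R) : continuous f -> continuous g ->
  continuous (fun x => f x + g x).
Proof. by move=> cf cg x; exact: (@continuousD R R^o X f g x (cf x) (cg x)). Qed.

Lemma continuous_mul X (f g : X -> R) : continuous f -> continuous g ->
  continuous (fun x => f x * g x).
Proof. by move=> cf cg x; exact: (@continuousM R X f g x (cf x) (cg x)). Qed.

Lemma continuous_affine X (a b : R) (f : X -> R) : continuous f ->
  continuous (fun x => a * f x + b).
Proof.
move=> cf; apply: continuous_add; last exact: cst_continuous.
by apply: continuous_mul => //; exact: cst_continuous.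
Qed.

End topology_lemmas.

Section paths.
Context {R : realType}.
Implicit Types S T : topologicalType.

Lemma joined_path T (g : R -> T) : continuous g -> joined (R := R) (g 0) (g 1).
Proof. by move=> cg; exists g; split => //; exact: continuous_subspaceT. Qed.

Lemma joinedP T (x y : T) : joined (R := R) x y ->
  exists2 g : R -> T, continuous g & g 0 = x /\ g 1 = y.
Proof.
move=> [g [cg g0 g1]]; exists (g \o clamp).
  apply: (within_continuous_retract cg).
    exact: continuous_clamp (@continuous_idfun _).
  by move=> t; rewrite /= in_itv/= clamp_itv.
by rewrite /= !clamp_id ?lexx ?ler01.
Qed.

Lemma joined_refl T (x : T) : joined (R := R) x x.
Proof. by apply: (@joined_path _ (cst x)); exact: cst_continuous. Qed.

Lemma joined_sym T (x y : T) : joined (R := R) x y -> joined (R := R) y x.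
Proof.
move=> /joinedP[g cg [<- <-]].
have := @joined_path _ (fun t => g (-1 * t + 1)).
rewrite mulr0 add0r mulr1 addNr; apply.
exact: continuous_after cg (continuous_affine (@continuous_idfun _)).
Qed.

Lemma joined_trans T (x y z : T) :
  joined (R := R) x y -> joined (R := R) y z -> joined (R := R) x z.
Proof.
move=> /joinedP[g cg [<- g1]] /joinedP[h ch [h0 <-]].
have := @joined_path _
  (fun t => if t <= 2^-1 then g (2 * t + 0) else h (2 * t + (-1))).
have -> : ((0 : R) <= 2^-1) by rewrite invr_ge0.
have -> : ((1 : R) <= 2^-1) = false by apply/negbTE; rewrite -ltNge invf_lt1// ltr1n.
have -> : 2 * 1 + -1 = 1 :> R by ring.
rewrite mulr0 addr0; apply; apply: continuous_paste.
- exact: continuous_idfun.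
- exact: continuous_after cg (continuous_affine (@continuous_idfun _)).
- exact: continuous_after ch (continuous_affine (@continuous_idfun _)).
- by move=> t ->; rewrite mulfV// addr0 subrr g1 h0.
Qed.

Lemma joined_map S T (f : S -> T) x y : continuous f ->
  joined (R := R) x y -> joined (R := R) (f x) (f y).
Proof.
move=> cf /joinedP[g cg [<- <-]]; apply: (@joined_path _ (f \o g)).
exact: continuous_after cf cg.
Qed.

Lemma joined_eq T (x y : T) : joined (R := R) x y ->
  joined (R := R) x = joined (R := R) y.
Proof.
move=> xy; apply/seteqP; split=> z; last exact: joined_trans.
exact/joined_trans/joined_sym.
Qed.

End paths.

Section spheroids.
Context {R : realType} {n : nat}.
Implicit Types (S T : topologicalType) (u : 'rV[R]_n).
Local Notation cube := (@cube R n).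
Local Notation cube_boundary := (@cube_boundary R n).

Definition to_cube u : 'rV[R]_n := \row_i clamp (u 0 i).

Lemma to_cube_in u : cube (to_cube u).
Proof. by move=> i; rewrite mxE clamp_itv. Qed.

Lemma to_cube_id u : cube u -> to_cube u = u.
Proof. by move=> cu; apply/rowP => i; rewrite mxE clamp_id. Qed.

Lemma continuous_coord (X : topologicalType) (F : X -> 'rV[R]_n) i :
  continuous F -> continuous (fun x => F x 0 i).
Proof.
move=> cF; apply: (continuous_after (g := fun u : 'rV[R]_n => u 0 i)) cF.
exact: coord_continuous.
Qed.

Lemma continuous_to_cube (X : topologicalType) (F : X -> 'rV[R]_n) :
  continuous F -> continuous (fun x => to_cube (F x)).
Proof.
move=> cF; apply: continuous_rV => i.
rewrite (_ : (fun x => _) = fun x => clamp (F x 0 i)).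
  by apply: continuous_clamp; exact: continuous_coord.
by apply/funext => x; rewrite mxE.
Qed.

Lemma spheroid_retract T (x : T) a : spheroid x a -> continuous (a \o to_cube).
Proof.
move=> [ca _]; apply: (within_continuous_retract ca) to_cube_in.
exact: continuous_to_cube (@continuous_idfun _).
Qed.

(** A homotopy relative to the boundary, normalized to be constant along the
  fibres of the retractions onto the interval and the cube: this makes it
  continuous everywhere, and pins down its ends outside the cube as well. *)
Lemma homotopicP T (x : T) (a b : 'rV[R]_n -> T) : spheroid_homotopic x a b ->
  exists2 H : R * 'rV[R]_n -> T, continuous H &
    [/\ forall u, H (0, u) = a (to_cube u),
        forall u, H (1, u) = b (to_cube u) &
        forall s u, cube_boundary u -> H (s, u) = x].
Proof.
move=> [H [cH H0 H1 Hx]].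
exists (H \o (fun z => (clamp z.1, to_cube z.2))).
  apply: (within_continuous_retract cH); last first.
    move=> z; split=> /=; last exact: to_cube_in.
    by rewrite /= in_itv/= clamp_itv.
  apply: continuous_pair.
    by apply: continuous_clamp => z; exact: cvg_fst.
  by apply: continuous_to_cube => z; exact: cvg_snd.
split=> [u|u|s u bu] /=.
- by rewrite clamp_id ?lexx ?ler01// H0//; exact: to_cube_in.
- by rewrite clamp_id ?lexx ?ler01// H1//; exact: to_cube_in.
- by rewrite to_cube_id ?Hx ?clamp_itv//; case: bu.
Qed.

Lemma homotopic_intro T (x : T) (a b : 'rV[R]_n -> T)
    (H : R * 'rV[R]_n -> T) : continuous H ->
  (forall u, cube u -> H (0, u) = a u) -> (forall u, cube u -> H (1, u) = b u) ->
  (forall s u, 0 <= s <= 1 -> cube_boundary u -> H (s, u) = x) ->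
  spheroid_homotopic x a b.
Proof. by move=> cH ? ? ?; exists H; split=> //; exact: continuous_subspaceT. Qed.

Lemma homotopic_refl T (x : T) (a : 'rV[R]_n -> T) :
  spheroid x a -> spheroid_homotopic x a a.
Proof.
move=> sa; apply: (@homotopic_intro _ _ _ _ (fun z => a (to_cube z.2))).
- apply: (continuous_after (g := a \o to_cube) (spheroid_retract sa)).
  by move=> z; exact: cvg_snd.
- by move=> u cu; rewrite to_cube_id.
- by move=> u cu; rewrite to_cube_id.
- by move=> s u _ bu; case: sa => _ /(_ _ bu) <-; rewrite /= to_cube_id//; case: bu.
Qed.

Lemma homotopic_sym T (x : T) (a b : 'rV[R]_n -> T) :
  spheroid_homotopic x a b -> spheroid_homotopic x b a.
Proof.
move=> /homotopicP[H cH [H0 H1 Hx]].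
apply: (@homotopic_intro _ _ _ _ (fun z => H (-1 * z.1 + 1, z.2))).
- apply: (continuous_after cH); apply: continuous_pair; last by move=> ?; exact: cvg_snd.
  by apply: continuous_affine => ?; exact: cvg_fst.
- by move=> u cu; rewrite mulr0 add0r H1 to_cube_id.
- by move=> u cu; rewrite mulr1 addNr H0 to_cube_id.
- by move=> s u _ bu; rewrite Hx.
Qed.

Lemma homotopic_trans T (x : T) (a b c : 'rV[R]_n -> T) :
  spheroid_homotopic x a b -> spheroid_homotopic x b c ->
  spheroid_homotopic x a c.
Proof.
move=> /homotopicP[H cH [H0 H1 Hx]] /homotopicP[K cK [K0 K1 Kx]].
apply: (@homotopic_intro _ _ _ _ (fun z => if z.1 <= 2^-1
    then H (2 * z.1 + 0, z.2) else K (2 * z.1 + -1, z.2))).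
- have cE (d : R) : continuous (fun z : R * 'rV[R]_n => (2 * z.1 + d, z.2)).
    apply: continuous_pair; last by move=> ?; exact: cvg_snd.
    by apply: continuous_affine => ?; exact: cvg_fst.
  apply: continuous_paste.
  + by move=> ?; exact: cvg_fst.
  + exact: continuous_after cH (cE 0).
  + exact: continuous_after cK (cE (-1)).
  + by move=> [s u] /= ->; rewrite mulfV// addr0 subrr H1 K0.
- move=> u cu /=; have -> : ((0 : R) <= 2^-1) by rewrite invr_ge0.
  by rewrite mulr0 addr0 H0 to_cube_id.
- move=> u cu /=.
  have -> : ((1 : R) <= 2^-1) = false by apply/negbTE; rewrite -ltNge invf_lt1// ltr1n.
  have -> : 2 * 1 + -1 = 1 :> R by ring.
  by rewrite K1 to_cube_id.
- by move=> s u _ bu /=; rewrite Hx// Kx//; case: ifP.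
Qed.

Lemma homotopic_map S T (f : S -> T) (x : S) (a b : 'rV[R]_n -> S) :
  continuous f -> spheroid_homotopic x a b ->
  spheroid_homotopic (f x) (f \o a) (f \o b).
Proof.
move=> cf /homotopicP[H cH [H0 H1 Hx]].
apply: (@homotopic_intro _ _ _ _ (f \o H)) => /=.
- exact: continuous_after cf cH.
- by move=> u cu; rewrite H0 to_cube_id.
- by move=> u cu; rewrite H1 to_cube_id.
- by move=> s u _ bu; rewrite Hx.
Qed.

Lemma spheroid_map S T (f : S -> T) (x : S) (a : 'rV[R]_n -> S) :
  continuous f -> spheroid x a -> spheroid (f x) (f \o a).
Proof.
move=> cf [ca ax]; split => [|u bu /=]; last by rewrite ax.
by apply: within_continuous_comp => // ? ?; exact: cf.
Qed.

Lemma spheroid_class_eq T (x : T) (a b : 'rV[R]_n -> T) :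
  spheroid_homotopic x a b -> spheroid_class x a = spheroid_class x b.
Proof.
move=> ab; apply/seteqP; split=> c [sc hc]; split => //.
  exact: homotopic_trans (homotopic_sym ab) hc.
exact: homotopic_trans ab hc.
Qed.

Lemma pi_map_class S T (f : S -> T) (x : S) (a : 'rV[R]_n -> S) :
  continuous f -> spheroid x a ->
  pi_map f x (spheroid_class x a) = spheroid_class (f x) (f \o a).
Proof.
move=> cf sa; apply/seteqP; split=> [b [a' [_ aa']]|b bfa].
  by rewrite (spheroid_class_eq (homotopic_map cf aa')).
by exists a => //; split=> //; exact: homotopic_refl.
Qed.

End spheroids.

(** * Fibrewise deformation retractions are weak equivalences *)

Section collar.
Context {R : realType} {n : nat}.
Implicit Types u : 'rV[R]_n.
Local Notation cube := (@cube R n).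
Local Notation cube_boundary := (@cube_boundary R n).

(** [stretch] blows up the central cube of side 1/2 onto the whole cube, and
  sends the collar around it to the boundary. *)
Definition stretch u : 'rV[R]_n := \row_i clamp (2 * u 0 i - 2^-1).

(** An affine function of the sup-distance to the centre, which is 0 on the
  boundary of the cube and 1 on that of the central cube. *)
Definition depth u : R := 2 - 4 * `|u - const_mx 2^-1|.

Lemma stretch_in u : cube (stretch u).
Proof. by move=> i; rewrite mxE clamp_itv. Qed.

Lemma to_cube_stretch u : to_cube (stretch u) = stretch u.
Proof. exact/to_cube_id/stretch_in. Qed.

Lemma continuous_stretch : continuous stretch.
Proof.
apply: continuous_rV => i.
rewrite (_ : (fun x => _) = fun x : 'rV[R]_n => clamp (2 * x 0 i - 2^-1)).
  apply/continuous_clamp/continuous_affine/continuous_coord.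
  exact: continuous_idfun.
by apply/funext => x; rewrite mxE.
Qed.

Lemma continuous_depth : continuous depth.
Proof.
have -> : depth = fun u => - 4 * `|u - const_mx 2^-1| + 2.
  by apply/funext => u; rewrite /depth; ring.
apply: continuous_affine => u.
apply: (@continuous_comp _ _ _ (fun u : 'rV[R]_n => u - const_mx 2^-1) Num.norm).
  exact: (cvgB (F := nbhs u) (f := id) (g := fun=> const_mx 2^-1) cvg_id (cvg_cst _)).
exact: norm_continuous.
Qed.

Lemma depth_boundary u : cube_boundary u -> depth u <= 0.
Proof.
move=> [_ [i ui]].
have : `|(u - const_mx 2^-1) 0 i| <= `|u - const_mx 2^-1|.
  rewrite [leRHS]/Num.norm/= mx_normrE.
  by apply/bigmax_geP; right; exists (0, i).
rewrite /depth !mxE; case: ui => ->; rewrite ler_norml ?ler_normr; lra.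
Qed.

Lemma stretch_collar u : depth u <= 1 -> cube_boundary (stretch u).
Proof.
move=> d1; split; first exact: stretch_in.
apply: contrapT => ni.
have : `|u - const_mx 2^-1| < 4^-1.
  rewrite [ltLHS]/Num.norm/= mx_normrE; apply/bigmax_ltP; split=> [|[k i] _ /=].
    by rewrite invr_gt0.
  rewrite (ord1 k) !mxE ltNge; apply/negP => ui; apply: ni; exists i.
  rewrite mxE; move: ui; rewrite ler_normr => /orP[ui|ui].
    by right; rewrite clamp_ge1//; lra.
  by left; rewrite clamp_le0//; lra.
by move: d1; rewrite /depth; lra.
Qed.

Definition slide (s : R) u : 'rV[R]_n :=
  \row_i ((1 - s) * u 0 i + s * stretch u 0 i).

Lemma slide0 u : slide 0 u = u.
Proof. by apply/rowP => i; rewrite mxE; ring. Qed.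

Lemma slide1 u : slide 1 u = stretch u.
Proof. by apply/rowP => i; rewrite mxE; ring. Qed.

(** Each face of the cube is mapped into itself by [stretch]. *)
Lemma slide_boundary s u : 0 <= s <= 1 -> cube_boundary u ->
  cube_boundary (slide s u).
Proof.
move=> /andP[s0 s1] [cu [i ui]]; split.
  move=> j; rewrite mxE; have /andP[u0 u1] := cu j.
  have /andP[v0 v1] := stretch_in u j; apply/andP; split; nra.
exists i; rewrite mxE mxE; case: ui => ->; [left|right].
  by rewrite clamp_le0; lra.
by rewrite clamp_ge1; lra.
Qed.

Lemma continuous_slide (X : topologicalType) (s : X -> R) (F : X -> 'rV[R]_n) :
  continuous s -> continuous F -> continuous (fun x => slide (s x) (F x)).
Proof.
move=> cs cF; apply: continuous_rV => i.
rewrite (_ : (fun x => _) =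
  fun x => (-1 * s x + 1) * F x 0 i + s x * stretch (F x) 0 i).
  apply: continuous_add; apply: continuous_mul => //.
  - exact: continuous_affine.
  - exact: continuous_coord.
  - apply: continuous_coord; exact: continuous_after continuous_stretch cF.
by apply/funext => x; rewrite mxE; ring.
Qed.

End collar.

(** [f] is a retraction with section [g], and [H] deforms the identity to
  [g \o f] inside the fibres of [f]. *)
Section deformation_retraction.
Context {R : realType} {S T : topologicalType}.
Variables (f : S -> T) (g : T -> S) (H : S -> R -> S).
Hypothesis f_cont : continuous f.
Hypothesis g_cont : continuous g.
Hypothesis H_cont : continuous (fun z : S * R => H z.1 z.2).
Hypothesis gK : cancel g f.
Hypothesis H0 : forall x, H x 0 = x.
Hypothesis H1 : forall x, H x 1 = g (f x).
Hypothesis fH : forall x t, f (H x t) = f x.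

Lemma fibre_path x : joined (R := R) x (g (f x)).
Proof.
rewrite -{1}(H0 x) -H1; apply: joined_path.
apply: (continuous_after H_cont (f := fun t => (x, t))).
by apply: continuous_pair; [exact: cst_continuous|exact: continuous_idfun].
Qed.

Lemma pi0_map_class x :
  pi0_map (R := R) f (joined (R := R) x) = joined (R := R) (f x).
Proof.
apply/seteqP; split=> [y [x' xx' fx'y]|y fxy]; last first.
  by exists x => //; exact: joined_refl.
by apply: joined_trans fx'y; exact: joined_map.
Qed.

Lemma pi0_bij : set_bij (@pi0 R S) (@pi0 R T) (pi0_map (R := R) f).
Proof.
split=> [_ [x _ <-]|C D|_ [y _ <-]].
- by exists (f x) => //; rewrite pi0_map_class.
- move=> /set_mem[x _ <-] /set_mem[x' _ <-]; rewrite !pi0_map_class => ff.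
  apply: joined_eq; apply: joined_trans (fibre_path x) _.
  apply: joined_trans (joined_sym (fibre_path x')).
  by apply: joined_map => //; rewrite ff; exact: joined_refl.
- exists (joined (R := R) (g y)); first by exists (g y).
  by rewrite pi0_map_class gK.
Qed.

Section base_point.
Variables (n : nat) (x : S).
Implicit Types u : 'rV[R]_n.

(** Change of base point along the path [H x]: the part of the cube where
  [depth] is at most 1 is a collar, which carries that path. *)
Definition pull_back (c : 'rV[R]_n -> S) u : S :=
  if depth u <= 1 then H x (clamp (depth u)) else c (stretch u).

Lemma continuous_base_path :
  continuous (fun u : 'rV[R]_n => H x (clamp (depth u))).
Proof.
apply: (continuous_after H_cont (f := fun u => (x, clamp (depth u)))).
apply: continuous_pair; first exact: cst_continuous.
exact/continuous_clamp/continuous_depth.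
Qed.

(** Letting [H] run for time [depth u] turns [a] into [g \o f \o a] on the
  central cube while the boundary stays at [x]. *)
Lemma spheroid_homotopic_pull_back a : spheroid x a ->
  spheroid_homotopic x a (pull_back ((g \o f) \o a)).
Proof.
move=> sa; have ca := spheroid_retract sa.
apply: (@homotopic_intro _ _ _ _ _ _ (fun z =>
  H (a (to_cube (slide z.1 z.2))) (z.1 * clamp (depth z.2)))).
- apply: (continuous_after H_cont
    (f := fun z => (a (to_cube (slide z.1 z.2)), z.1 * clamp (depth z.2)))).
  have c1 : continuous (fst : R * 'rV[R]_n -> R) by move=> ?; exact: cvg_fst.
  have c2 : continuous (snd : R * 'rV[R]_n -> 'rV[R]_n) by move=> ?; exact: cvg_snd.
  apply: continuous_pair.
    exact: continuous_after ca (continuous_slide c1 c2).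
  apply: continuous_mul => //.
  exact: continuous_clamp (continuous_after continuous_depth c2).
- by move=> u cu /=; rewrite mul0r H0 slide0 to_cube_id.
- move=> u cu /=; rewrite mul1r slide1 to_cube_stretch /pull_back.
  case: ifPn => [d1|]; first by case: sa => _ -> //; exact: stretch_collar.
  by rewrite -ltNge => /ltW d1; rewrite clamp_ge1//= H1.
- move=> s u s01 bu /=; have bs := slide_boundary s01 bu.
  rewrite to_cube_id; last by case: bs.
  by case: sa => _ ->//; rewrite clamp_le0 ?mulr0 ?H0//; exact: depth_boundary.
Qed.

Lemma pull_back_homotopic c d : spheroid_homotopic (g (f x)) c d ->
  spheroid_homotopic x (pull_back c) (pull_back d).
Proof.
move=> /homotopicP[K cK [K0 K1 Kx]].
apply: (@homotopic_intro _ _ _ _ _ _ (fun z =>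
  if depth z.2 <= 1 then H x (clamp (depth z.2)) else K (z.1, stretch z.2))).
- have c1 : continuous (fst : R * 'rV[R]_n -> R) by move=> ?; exact: cvg_fst.
  have c2 : continuous (snd : R * 'rV[R]_n -> 'rV[R]_n) by move=> ?; exact: cvg_snd.
  apply: continuous_paste.
  + exact: continuous_after continuous_depth c2.
  + exact: continuous_after continuous_base_path c2.
  + apply: (continuous_after cK); apply: continuous_pair => //.
    exact: continuous_after continuous_stretch c2.
  + move=> z d1; rewrite d1 clamp_id ?lexx ?ler01// H1 Kx//.
    by apply: stretch_collar; rewrite d1.
- by move=> u cu; rewrite /pull_back /= K0 to_cube_stretch.
- by move=> u cu; rewrite /pull_back /= K1 to_cube_stretch.
- move=> s u _ bu /=; have d0 := depth_boundary bu.
  by rewrite (le_trans d0 ler01) clamp_le0// H0.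
Qed.

Lemma spheroid_pull_back c : spheroid (g (f x)) c -> spheroid x (pull_back c).
Proof.
move=> sc; split.
  have cc := spheroid_retract sc.
  rewrite (_ : pull_back c = fun u => if depth u <= 1
    then H x (clamp (depth u)) else (c \o to_cube) (stretch u)).
    apply: continuous_subspaceT; apply: continuous_paste.
    - exact: continuous_depth.
    - exact: continuous_base_path.
    - exact: continuous_after cc continuous_stretch.
    - move=> u d1; rewrite d1 clamp_id ?lexx ?ler01// H1 /= to_cube_stretch.
      by case: sc => _ ->//; apply: stretch_collar; rewrite d1.
  by apply/funext => u; rewrite /= to_cube_stretch.
move=> u bu; have d0 := depth_boundary bu.
by rewrite /pull_back (le_trans d0 ler01) clamp_le0// H0.
Qed.

(** [f] contracts the collar to the base point because [H] is fibrewise, so that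
  only a reparametrization of [c] is left. *)
Lemma spheroid_lift c : spheroid (f x) c ->
  spheroid_homotopic (f x) (f \o pull_back (g \o c)) c.
Proof.
move=> sc; have cc := spheroid_retract sc.
have -> : f \o pull_back (g \o c) = c \o stretch.
  apply/funext => u; rewrite /pull_back /=; case: ifPn => [d1|_]; last by rewrite gK.
  by rewrite fH; case: sc => _ -> //; exact: stretch_collar.
apply: homotopic_sym.
apply: (@homotopic_intro _ _ _ _ _ _ (fun z => c (to_cube (slide z.1 z.2)))).
- have c1 : continuous (fst : R * 'rV[R]_n -> R) by move=> ?; exact: cvg_fst.
  have c2 : continuous (snd : R * 'rV[R]_n -> 'rV[R]_n) by move=> ?; exact: cvg_snd.
  exact: continuous_after cc (continuous_slide c1 c2).
- by move=> u cu /=; rewrite slide0 to_cube_id.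
- by move=> u cu /=; rewrite slide1 to_cube_stretch.
- move=> s u s01 bu /=; have bs := slide_boundary s01 bu.
  by rewrite to_cube_id; [case: sc => _ ->|case: bs].
Qed.

Lemma pi_bij : set_bij (@pi_ R n S x) (@pi_ R n T (f x)) (pi_map f x).
Proof.
split=> [_ [a sa <-]|C D|_ [c sc <-]].
- by exists (f \o a); [exact: spheroid_map|rewrite pi_map_class].
- move=> /set_mem[a sa <-] /set_mem[b sb <-]; rewrite !pi_map_class// => fab.
  have {}fab : spheroid_homotopic (f x) (f \o a) (f \o b).
    have : spheroid_class (f x) (f \o b) (f \o b).
      split; first exact: spheroid_map.
      by apply: homotopic_refl; exact: spheroid_map.
    by rewrite -fab => -[].
  apply: spheroid_class_eq; apply: homotopic_trans (spheroid_homotopic_pull_back sa) _.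
  apply: homotopic_trans (homotopic_sym (spheroid_homotopic_pull_back sb)).
  exact: pull_back_homotopic (homotopic_map g_cont fab).
- have sp : spheroid x (pull_back (g \o c)).
    by apply: spheroid_pull_back; exact: spheroid_map.
  exists (spheroid_class x (pull_back (g \o c))); first by exists (pull_back (g \o c)).
  by rewrite pi_map_class//; apply: spheroid_class_eq; exact: spheroid_lift.
Qed.

End base_point.

(** Classes of maps into [S] are detected by [f] because they can be recovered
  from their image under [g \o f], by change of base point along the path that
  [H] draws from [x]; they are all reached because the images under [g] can be
  brought to base point [x] along the same path. *)
Lemma fibrewise_retraction_weak_equivalence : weak_equivalence R f.
Proof. by split=> // [|n x _]; [exact: pi0_bij|exact: pi_bij]. Qed.

End deformation_retraction.

(** * Collapses and interleavings of filtered complexes *)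

Section filtered_collapse.
Context {R : realType}.
Implicit Types V W : choiceType.

Lemma simplicial_map_incl_comm V W (K K' : simplicial_complex V)
    (L L' : simplicial_complex W) (p : V -> W) (Kp : simplicial K L p)
    (K'p : simplicial K' L' p) (KK' : simplex K `<=` simplex K')
    (LL' : simplex L `<=` simplex L') (x : realization R K) :
  simplicial_map K'p (realization_incl KK' x) =
  realization_incl LL' (simplicial_map Kp x).
Proof. exact/realization_eqP. Qed.

Lemma collapse_weak_equivalence V W (K : simplicial_complex V)
    (L : simplicial_complex W) (p : V -> W) (sec : W -> V)
    (le : V -> V -> Prop) (Kp : simplicial K L p) :
  simplicial L K sec -> cancel sec p ->
  (forall u v w, le u v -> le v w -> le u w) ->
  (forall s, simplex K s -> forall v w, s v -> s w -> le v w \/ le w v) ->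
  (forall s u w, simplex K s -> u `<=` s -> w `<=` s ->
    (forall v v', u v -> w v' -> le v v') ->
    u `|` (sec \o p) @` w !=set0 -> simplex K (u `|` (sec \o p) @` w)) ->
  weak_equivalence R (simplicial_map (R := R) Kp).
Proof.
move=> Ls secK le_tr le_tot push.
apply: (@fibrewise_retraction_weak_equivalence _ _ _ _
  (simplicial_map Ls) (sweep le_tr le_tot push)).
- exact: simplicial_map_continuous.
- exact: simplicial_map_continuous.
- exact: sweep_continuous.
- move=> y; apply/realization_eqP => w /=.
  rewrite mass_image_comp; last exact: supp_finite.
  by rewrite mass_image_id//; exact: supp_finite.
- by move=> x; exact: sweep0.
- move=> x; apply/realization_eqP => w; rewrite sweep1 /= mass_image_comp//.
  exact: supp_finite.
- move=> x t; apply/realization_eqP => w.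
  by apply: mass_image_sweep => v /=; rewrite secK.
Qed.

(** The functorial form of [collapse_weak_equivalence]: only the forward map has
  to be natural, the section and the homotopy may be used index by index. *)
Lemma collapse_weakly_equivalent k V W (K : index R k -> simplicial_complex V)
    (L : index R k -> simplicial_complex W)
    (K_mono : forall a b, index_le a b -> simplex (K a) `<=` simplex (K b))
    (L_mono : forall a b, index_le a b -> simplex (L a) `<=` simplex (L b))
    (p : V -> W) (sec : W -> V) (le : V -> V -> Prop) :
  (forall a, simplicial (K a) (L a) p) -> (forall a, simplicial (L a) (K a) sec) ->
  cancel sec p ->
  (forall u v w, le u v -> le v w -> le u w) ->
  (forall a s, simplex (K a) s -> forall v w, s v -> s w -> le v w \/ le w v) ->
  (forall a s u w, simplex (K a) s -> u `<=` s -> w `<=` s ->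
    (forall v v', u v -> w v' -> le v v') ->
    u `|` (sec \o p) @` w !=set0 -> simplex (K a) (u `|` (sec \o p) @` w)) ->
  weakly_equivalent (filtration_functor K_mono) (filtration_functor L_mono).
Proof.
move=> Kp Ls secK le_tr le_tot push; apply: Relation_Operators.rst_step.
exists (@NatTrans R k (filtration_functor K_mono) (filtration_functor L_mono)
  (fun a => simplicial_map (Kp a)) (fun a => @simplicial_map_continuous _ _ _ _ _ _ (Kp a))
  (fun a b ab x => simplicial_map_incl_comm (Kp a) (Kp b) (K_mono a b ab) (L_mono a b ab) x)).
move=> a; exact: (collapse_weak_equivalence (Kp a) (Ls a) secK le_tr (le_tot a) (push a)).
Qed.

Lemma realization_incl_comm V (K K' L L' : simplicial_complex V)
    (KL : simplex K `<=` simplex L) (K'L' : simplex K' `<=` simplex L')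
    (KK' : simplex K `<=` simplex K') (LL' : simplex L `<=` simplex L')
    (x : realization R K) :
  realization_incl K'L' (realization_incl KK' x) =
  realization_incl LL' (realization_incl KL x).
Proof. exact/realization_eqP. Qed.

Lemma inclusion_interleaved k V (K L : index R k -> simplicial_complex V)
    (K_mono : forall a b, index_le a b -> simplex (K a) `<=` simplex (K b))
    (L_mono : forall a b, index_le a b -> simplex (L a) `<=` simplex (L b))
    (d : {nonneg R}) :
  (forall a, simplex (K a) `<=` simplex (L (shift d a))) ->
  (forall a, simplex (L a) `<=` simplex (K (shift d a))) ->
  interleaved d (filtration_functor K_mono) (filtration_functor L_mono).
Proof.
move=> KL LK.
exists (@NatTrans R k (filtration_functor K_mono) (pshift d (filtration_functor L_mono))
  (fun a => realization_incl (KL a))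
  (fun a => @realization_incl_continuous _ _ _ _ (KL a))
  (fun a b ab x => realization_incl_comm (KL a) (KL b) (K_mono a b ab)
     (L_mono _ _ (shift_le d ab)) x)).
exists (@NatTrans R k (filtration_functor L_mono) (pshift d (filtration_functor K_mono))
  (fun a => realization_incl (LK a))
  (fun a => @realization_incl_continuous _ _ _ _ (LK a))
  (fun a b ab x => realization_incl_comm (LK a) (LK b) (L_mono a b ab)
     (K_mono _ _ (shift_le d ab)) x)).
by split=> a x; exact/realization_eqP.
Qed.

End filtered_collapse.

Section preimage_complex.
Context {R : realType} {V W : choiceType}.
Variables (p : V -> W).

Section complex.
Variable L : simplicial_complex W.

Definition preimage_simplex : set (set V) :=
  [set s | finite_set s /\ simplex L (p @` s)].

Lemma preimage_simplex_neq0 s : preimage_simplex s -> s !=set0.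
Proof. by move=> [_ /simplex_neq0[_ [v sv _]]]; exists v. Qed.

Lemma preimage_simplex_face s u :
  preimage_simplex s -> u `<=` s -> u !=set0 -> preimage_simplex u.
Proof.
move=> [fs Ls] us [v uv]; split; first exact: sub_finite_set fs.
by apply: simplex_face Ls _ _; [exact: image_subset|exists (p v), v].
Qed.

Definition preimage_complex : simplicial_complex V :=
  @SimplicialComplex V preimage_simplex (fun s => @proj1 _ _) preimage_simplex_neq0 preimage_simplex_face.

End complex.

Lemma preimage_complex_mono (L L' : simplicial_complex W) :
  simplex L `<=` simplex L' ->
  simplex (preimage_complex L) `<=` simplex (preimage_complex L').
Proof. by move=> LL' s [fs Ls]; split=> //; exact: LL'. Qed.

(** With the preorder that relates everything, the condition on simplices is
  that a simplex can be completed by the other points of its fibres, which is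
  what a preimage complex allows. *)
Lemma preimage_weakly_equivalent k (L : index R k -> simplicial_complex W)
    (L_mono : forall a b, index_le a b -> simplex (L a) `<=` simplex (L b)) :
  set_surj setT setT p ->
  weakly_equivalent
    (filtration_functor (fun a b ab => preimage_complex_mono (L_mono a b ab)))
    (filtration_functor L_mono).
Proof.
move=> p_surj.
have /choice[sec secK] : forall w, exists v, p v = w.
  by move=> w; have [v _ <-] := p_surj w I; exists v.
apply: (@collapse_weakly_equivalent _ _ _ _ _ _ _ _ p sec (fun _ _ => True)) => //.
- by move=> a s [].
- move=> a s Ls; split; first exact/finite_image/(simplex_finite Ls).
  rewrite image_comp (_ : p \o sec = id) ?image_id//.
  exact/funext.
- by move=> *; left.
- move=> a s u w [fs Ls] us ws _ [v uwv]; split.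
    rewrite finite_setU; split; first exact: sub_finite_set fs.
    by apply: finite_image; exact: sub_finite_set fs.
  apply: simplex_face Ls _ _; last by exists (p v), v.
  move=> _ [v' [uv'|[w' ww' <-]] <-]; first by exists v' => //; exact: us.
  by rewrite /= secK; exists w' => //; exact: ws.
Qed.

End preimage_complex.

Section metric_estimates.
Context {R : realType}.

Lemma sup0_shift (S S' : set (\bar R)) (e : R) : 0 <= e ->
  (forall z, S' z -> exists2 y, S y & (z <= y + e%:E)%E) ->
  (sup0 S' <= sup0 S + e%:E)%E.
Proof.
move=> e0 SS'; apply: ge_ereal_sup => z [->|/SS'[y Sy]].
  by rewrite adde_ge0 ?lee_fin//; apply: ereal_sup_ubound; left.
by move=> /le_trans; apply; rewrite leeD2r//; apply: ereal_sup_ubound; right.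
Qed.

Lemma diam_shift (T T' : metricType R) (A : set T) (A' : set T') (e : R) :
  0 <= e ->
  (forall x' y', A' x' -> A' y' -> exists x y,
    [/\ A x, A y & mdist x' y' <= mdist x y + e]) ->
  (diam A' <= diam A + e%:E)%E.
Proof.
move=> e0 AA'; apply: sup0_shift => // _ [[x' y'] [/= Ax' Ay'] <-].
have [x [y [Ax Ay xy]]] := AA' _ _ Ax' Ay'.
by exists (mdist x y)%:E; [exists (x, y)|rewrite -EFinD lee_fin].
Qed.

Lemma rad_shift (B : metricType R) (C C' : set B) (e : R) : 0 <= e ->
  (forall c', C' c' -> exists2 c, C c & mdist c c' <= e) ->
  (rad C' <= rad C + e%:E)%E.
Proof.
move=> e0 CC'; rewrite -leeBlDr//; apply: le_ereal_inf_tmp => _ [b _ <-].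
rewrite leeBlDr//; apply: (@le_trans _ _ (sup0 [set (mdist b c)%:E | c in C'])).
  by apply: ereal_inf_lbound; exists b.
apply: sup0_shift => // _ [c' Cc' <-]; have [c Cc cc'] := CC' _ Cc'.
exists (mdist b c)%:E; first by exists c.
rewrite -EFinD lee_fin; apply: le_trans (metric_triangle b c c') _.
by rewrite lerD2l.
Qed.

End metric_estimates.

(** * The Gromov-Hausdorff bound *)

Section gromov_hausdorff.
Context {R : realType}.

Lemma preimage_homotopy_interleaved k (V W W' : choiceType)
    (p : V -> W) (q : V -> W') (L : index R k -> simplicial_complex W)
    (L' : index R k -> simplicial_complex W')
    (L_mono : forall a b, index_le a b -> simplex (L a) `<=` simplex (L b))
    (L'_mono : forall a b, index_le a b -> simplex (L' a) `<=` simplex (L' b))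
    (d : {nonneg R}) :
  set_surj setT setT p -> set_surj setT setT q ->
  (forall a s, finite_set s -> simplex (L a) (p @` s) ->
     simplex (L' (shift d a)) (q @` s)) ->
  (forall a s, finite_set s -> simplex (L' a) (q @` s) ->
     simplex (L (shift d a)) (p @` s)) ->
  homotopy_interleaved d (filtration_functor L_mono) (filtration_functor L'_mono).
Proof.
move=> p_surj q_surj LL' L'L.
exists (filtration_functor (fun a b ab => @preimage_complex_mono _ _ p _ _ (L_mono a b ab))).
exists (filtration_functor (fun a b ab => @preimage_complex_mono _ _ q _ _ (L'_mono a b ab))).
split.
- by apply: Relation_Operators.rst_sym; exact: preimage_weakly_equivalent.
- by apply: Relation_Operators.rst_sym; exact: preimage_weakly_equivalent.
- by apply: inclusion_interleaved => a s [fs Ls]; split=> //;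
    [exact: LL'|exact: L'L].
Qed.

Lemma mul2_inf (x : \bar R) (S : set (\bar R)) :
  (forall d, S d -> (x <= 2%:E * d)%E) -> (x <= 2%:E * ereal_inf S)%E.
Proof.
move=> xS; rewrite -lee_pdivrMl//; apply: le_ereal_inf_tmp => d Sd.
by rewrite lee_pdivrMl//; exact: xS.
Qed.

Lemma d_HI_le k (M N : pfunctor R k) (e : R) (e0 : 0 <= 2 * e) :
  homotopy_interleaved (NngNum e0) M N -> (d_HI M N <= 2%:E * e%:E)%E.
Proof. by move=> MN; apply: ereal_inf_lbound; exists (NngNum e0). Qed.

Variable B : metricType R.

Lemma VR2_simplex_transfer (X Y : bField B) (V : Type) (p : V -> X) (q : V -> Y)
    (A : set V) (e r s : R) : 0 <= e -> finite_set A ->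
  (forall v w, mdist (q v) (q w) <= mdist (p v) (p w) + 2 * e) ->
  (forall v, mdist (bf_proj (p v)) (bf_proj (q v)) <= e) ->
  VR2_simplex r s (p @` A) -> VR2_simplex (r + 2 * e) (s + 2 * e) (q @` A).
Proof.
move=> e0 fA pq_dist pq_proj [_ [_ [v Av _]] dA rA]; split.
- exact: finite_image.
- by exists (q v), v.
- rewrite EFinD; apply: (@le_trans _ _ (diam (p @` A) + (2 * e)%:E)%E).
    apply: diam_shift => [|_ _ [x Ax <-] [y Ay <-]]; first by rewrite mulr_ge0.
    by exists (p x), (p y); split=> //; exact: imageP.
  exact: leeD2r.
- have -> : (s + 2 * e) / 2 = s / 2 + e by lra.
  rewrite EFinD; apply: (@le_trans _ _ (rad (@bf_proj _ _ X @` (p @` A)) + e%:E)%E).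
    apply: rad_shift => // _ [_ [x Ax <-] <-].
    by exists (bf_proj (p x)) => //; exists (p x) => //; exists x.
  exact: leeD2r.
Qed.

(** The set of [e]-close pairs is a correspondence between [X] and [Y]; distances
  change by at most [2 * e] along it, and projections to the base by at most
  [e], which is what the factor 1/2 in the bound on the radius asks for. *)
Lemma VR2_interleaved (X Y Z : bField B) (f : X -> Z) (g : Y -> Z) (e : R)
    (e0 : 0 <= 2 * e) :
  field_embedding f -> field_embedding g ->
  range f `<=` thickening (range g) e -> range g `<=` thickening (range f) e ->
  homotopy_interleaved (NngNum e0) (VR2 X) (VR2 Y).
Proof.
move=> [f_iso f_proj] [g_iso g_proj] fg gf.
pose V : choiceType := {v : X * Y | `[< mdist (f v.1) (g v.2) < e >]}.
pose p (v : V) : X := (val v).1; pose q (v : V) : Y := (val v).2.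
have e0' : 0 <= e by move: e0; rewrite pmulr_rge0.
have close (v : V) : mdist (f (p v)) (g (q v)) <= e.
  by have /asboolP/ltW := valP v.
have proj (v : V) : mdist (bf_proj (p v)) (bf_proj (q v)) <= e.
  rewrite -f_proj -g_proj; apply: le_trans (close v); exact: bf_proj_lip.
have dist (v w : V) : mdist (p v) (p w) <= mdist (q v) (q w) + 2 * e.
  rewrite -(f_iso (p v)) -(g_iso (q v)).
  have := metric_triangle (f (p v)) (g (q v)) (f (p w)).
  have := metric_triangle (g (q v)) (g (q w)) (f (p w)).
  have := close v; have := close w; rewrite (metric_sym (g (q w))); lra.
have dist' (v w : V) : mdist (q v) (q w) <= mdist (p v) (p w) + 2 * e.
  rewrite -(f_iso (p v)) -(g_iso (q v)).
  have := metric_triangle (g (q v)) (f (p v)) (g (q w)).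
  have := metric_triangle (f (p v)) (f (p w)) (g (q w)).
  have := close v; have := close w; rewrite (metric_sym (g (q v)) (f (p v))); lra.
rewrite /VR2; apply: (@preimage_homotopy_interleaved _ V _ _ p q).
- move=> x _; have [_ [y _ <-] yx] : thickening (range g) e (f x).
    by apply: fg; exists x.
  have xy : `[< mdist (f (x, y).1) (g (x, y).2) < e >].
    by apply/asboolP; rewrite metric_sym.
  by exists (exist _ (x, y) xy).
- move=> y _; have [_ [x _ <-] xy] : thickening (range f) e (g y).
    by apply: gf; exists y.
  have xy' : `[< mdist (f (x, y).1) (g (x, y).2) < e >] by exact/asboolP.
  by exists (exist _ (x, y) xy').
- by move=> a s fs; exact: VR2_simplex_transfer.
- move=> a s fs; apply: VR2_simplex_transfer => // v.
  by rewrite metric_sym.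
Qed.

Lemma d_HI_VR2_le (X Y : bField B) : (d_HI (VR2 X) (VR2 Y) <= 2%:E * d_GH X Y)%E.
Proof.
apply: mul2_inf => _ [Z [f [g [ef eg ->]]]]; apply: mul2_inf => _ [e [e0 fg gf] <-].
have e2 : 0 <= 2 * e by rewrite mulr_ge0// ltW.
by apply: (d_HI_le (e0 := e2)); exact: VR2_interleaved ef eg fg gf.
Qed.

End gromov_hausdorff.

(** * The Gromov-Prokhorov bound *)

Section chains.
Context {R : realType}.

Definition chain_simplex (V : choiceType) (le : V -> V -> Prop) (P : set V) :
    set (set V) :=
  [set s | [/\ finite_set s, s !=set0,
    forall v w, s v -> s w -> le v w \/ le w v & s `<=` P]].

Lemma chain_simplex_face (V : choiceType) (le : V -> V -> Prop) (P : set V) s u :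
  chain_simplex le P s -> u `<=` s -> u !=set0 -> chain_simplex le P u.
Proof.
move=> [fs _ cs sP] us u0; split=> //; first exact: sub_finite_set fs.
  by move=> v w /us sv /us sw; exact: cs.
exact: subset_trans sP.
Qed.

Definition chain_complex (V : choiceType) (le : V -> V -> Prop) (P : set V) :
    simplicial_complex V :=
  @SimplicialComplex V (chain_simplex le P)
    (fun s h => let: And4 fs _ _ _ := h in fs)
    (fun s h => let: And4 _ s0 _ _ := h in s0)
    (@chain_simplex_face V le P).

Lemma chain_complex_mono (V : choiceType) (le : V -> V -> Prop) (P Q : set V) :
  P `<=` Q -> simplex (chain_complex le P) `<=` simplex (chain_complex le Q).
Proof. by move=> PQ s [fs s0 cs sP]; split=> //; exact: subset_trans PQ. Qed.

Lemma chain_simplex_image (V W : choiceType) (le : V -> V -> Prop)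
    (le' : W -> W -> Prop) (P : set V) (Q : set W) (p : V -> W) s :
  (forall v w, le v w -> le' (p v) (p w)) -> (forall v, P v -> Q (p v)) ->
  chain_simplex le P s -> chain_simplex le' Q (p @` s).
Proof.
move=> pm PQ [fs [v sv] cs sP]; split.
- exact: finite_image.
- by exists (p v), v.
- move=> _ _ [x sx <-] [y sy <-].
  by have [/pm|/pm] := cs _ _ sx sy; [left|right].
- by move=> _ [x sx <-]; exact/PQ/sP.
Qed.

(** Order-preserving maps [p] and [sec] with [p (sec w) = w] and
  [v <= sec (p v)] form a Galois connection, whose order complexes are
  homotopy equivalent. *)
Lemma chain_weakly_equivalent k (V W : choiceType)
    (K : index R k -> simplicial_complex V)
    (L : index R k -> simplicial_complex W)
    (K_mono : forall a b, index_le a b -> simplex (K a) `<=` simplex (K b))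
    (L_mono : forall a b, index_le a b -> simplex (L a) `<=` simplex (L b))
    (le : V -> V -> Prop) (le' : W -> W -> Prop)
    (P : index R k -> set V) (Q : index R k -> set W)
    (p : V -> W) (sec : W -> V) :
  (forall a s, simplex (K a) s <-> chain_simplex le (P a) s) ->
  (forall a s, simplex (L a) s <-> chain_simplex le' (Q a) s) ->
  (forall u v w, le u v -> le v w -> le u w) ->
  (forall v w, le v w -> le' (p v) (p w)) ->
  (forall v w, le' v w -> le (sec v) (sec w)) ->
  (forall a v, P a v -> Q a (p v)) -> (forall a w, Q a w -> P a (sec w)) ->
  cancel sec p -> (forall v, le v (sec (p v))) ->
  weakly_equivalent (filtration_functor K_mono) (filtration_functor L_mono).
Proof.
move=> KE LE le_tr p_mono sec_mono PQ QP secK unit.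
apply: (@collapse_weakly_equivalent _ _ _ _ _ _ _ _ p sec le) => //.
- by move=> a s /KE Ks; apply/LE; exact: (chain_simplex_image p_mono (PQ a) Ks).
- by move=> a s /LE Ls; apply/KE; exact: (chain_simplex_image sec_mono (QP a) Ls).
- by move=> a s /KE[].
- move=> a s u w /KE[fs _ cs sP] us ws uw uw0; apply/KE; split=> //.
  + rewrite finite_setU; split; first exact: sub_finite_set fs.
    by apply: finite_image; exact: sub_finite_set fs.
  + move=> x y [ux|[v wv <-]] [uy|[v' wv' <-]].
    * exact: cs (us _ ux) (us _ uy).
    * by left; exact: le_tr (uw _ _ ux wv') (unit v').
    * by right; exact: le_tr (uw _ _ uy wv) (unit v).
    * by have [|] := cs _ _ (ws _ wv) (ws _ wv'); [left|right];
        apply/sec_mono/p_mono.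
  + by move=> x [/us/sP//|[v /ws/sP Pv <-]]; exact/QP/PQ.
Qed.

End chains.

Section thickenings.
Context {R : realType}.
Implicit Types T : metricType R.

Lemma nbhs_mdist T (x : T) (e : R) : 0 < e -> nbhs x [set y | mdist x y < e].
Proof. by move=> e0; rewrite -ballEmdist; exact: nbhsx_ballx. Qed.

Lemma isometry_continuous T T' (f : T -> T') :
  (forall x y, mdist (f x) (f y) = mdist x y) -> continuous f.
Proof.
move=> f_iso x A /nbhs_ballP[e /= e0]; rewrite ballEmdist => eA.
apply: filterS (nbhs_mdist x e0) => y /= xy; apply: eA.
by rewrite /= f_iso.
Qed.

Lemma thickening_open T (A : set T) e : open (thickening A e).
Proof.
rewrite openE => x [a Aa ax]; rewrite /interior.
have e0 : 0 < e - mdist a x by rewrite subr_gt0.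
apply: filterS (nbhs_mdist x e0) => y /= xy; exists a => //.
by apply: le_lt_trans (metric_triangle a x y) _; rewrite -ltrBrDl.
Qed.

Lemma sub_thickening T (A : set T) e : 0 < e -> A `<=` thickening A e.
Proof. by move=> e0 x Ax; exists x => //; rewrite mdistxx. Qed.

Lemma thickening_sub T (A C : set T) e :
  A `<=` C -> thickening A e `<=` thickening C e.
Proof. by move=> AC x [a /AC Ca ax]; exists a. Qed.

Lemma thickening_closure T (A : set T) e :
  thickening (closure A) e `<=` thickening A e.
Proof.
move=> x [c Ac cx].
have e0 : 0 < e - mdist c x by rewrite subr_gt0.
have [a [Aa /= ca]] := Ac _ (nbhs_mdist c e0).
exists a => //; apply: le_lt_trans (metric_triangle a c x) _.
by rewrite metric_sym -ltrBrDr.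
Qed.

Lemma open_borel (T : topologicalType) (A : set T) : open A -> borel A.
Proof. exact: sub_sigma_algebra. Qed.

Lemma closed_borel (T : topologicalType) (A : set T) : closed A -> borel A.
Proof.
move=> cA; rewrite -(setCK A) -[~` ~` A]setTD.
by apply: sigma_algebraCD; apply: open_borel; exact: closed_openC.
Qed.

End thickenings.

Section gromov_prokhorov.
Context {R : realType} {B : metricType R} (Z : bField B).
Variables (W : bool -> mmField B) (h : forall b, W b -> Z) (e : R).
Hypothesis e_gt0 : 0 < e.
Hypothesis h_emb : forall b, field_embedding (@h b).
Hypothesis prokhorov : forall b (A : set Z), borel A ->
  (mm_measure (W b) (@h b @^-1` A) <=
   mm_measure (W (~~ b)) (@h (~~ b) @^-1` thickening A e) + e%:E)%E.

Let h_cont b : continuous (@h b).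
Proof. by apply: isometry_continuous; case: (h_emb b). Qed.

Lemma le_mm_measure b (A C : set (W b)) : borel A -> borel C -> A `<=` C ->
  (mm_measure (W b) A <= mm_measure (W b) C)%E.
Proof. by move=> bA bC AC; apply: le_measure => //; rewrite inE. Qed.

(** The subsets of [Z] that stand for vertices of the trifiltration of [W b].
  Only the trace of [A] on [W b] is asked to be Borel: in this way direct
  images of Borel sets qualify for free. *)
Definition ambient_vertex b (r s t : R) : set (set Z) :=
  [set A | [/\ borel (@h b @^-1` A), (diam A <= r%:E)%E,
    (rad (@bf_proj _ _ Z @` A) <= (s / 2)%:E)%E &
    ((1 - t)%:E <= mm_measure (W b) (@h b @^-1` A))%E]].

Lemma ambient_vertex_mono b r s t r' s' t' : r <= r' -> s <= s' -> t <= t' ->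
  ambient_vertex b r s t `<=` ambient_vertex b r' s' t'.
Proof.
move=> rr ss tt A [bA dA rA mA]; split=> //.
- by apply: le_trans dA _; rewrite lee_fin.
- by apply: le_trans rA _; rewrite lee_fin ler_pM2r.
- by apply: le_trans _ mA; rewrite lee_fin lerB.
Qed.

(** The Prokhorov inequality is applied to the closure of [A], which has the
  same thickening and is Borel, whereas [A] is only known to have a Borel trace
  on [W b]. *)
Lemma ambient_vertex_thickening b r s t A : ambient_vertex b r s t A ->
  ambient_vertex (~~ b) (r + 2 * e) (s + 2 * e) (t + 2 * e) (thickening A e).
Proof.
move=> [bA dA rA mA].
have bT b' (A' : set Z) : borel (@h b' @^-1` thickening A' e).
  apply: open_borel; apply: open_comp; last exact: thickening_open.
  by move=> ? _; exact: h_cont.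
split=> //.
- rewrite EFinD; apply: (@le_trans _ _ (diam A + (2 * e)%:E)%E); last exact: leeD2r.
  apply: diam_shift => [|x y [a Aa ax] [c Ac cy]]; first by rewrite mulr_ge0// ltW.
  exists a, c; split=> //.
  have := metric_triangle x a y; have := metric_triangle a c y.
  rewrite (metric_sym x a); lra.
- have -> : (s + 2 * e) / 2 = s / 2 + e by lra.
  rewrite EFinD; apply: (@le_trans _ _ (rad (@bf_proj _ _ Z @` A) + e%:E)%E).
    apply: rad_shift => [|_ [x [a Aa ax] <-]]; first exact: ltW.
    exists (bf_proj a); first by exists a.
    exact: le_trans (bf_proj_lip _ _) (ltW ax).
  exact: leeD2r.
- have bC : borel (@h b @^-1` closure A).
    apply: closed_borel; apply: preimage_closed; last exact: closed_closure.
    by move=> ? _; exact: h_cont.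
  have AC : (mm_measure (W b) (@h b @^-1` A) <=
             mm_measure (W b) (@h b @^-1` closure A))%E.
    by apply: le_mm_measure => // x /=; exact: (@subset_closure _ A).
  have := prokhorov b (closed_borel (@closed_closure _ A)).
  move=> /(le_trans AC)/(le_trans mA) m1.
  have m2 : (mm_measure (W (~~ b)) (@h (~~ b) @^-1` thickening (closure A) e) <=
             mm_measure (W (~~ b)) (@h (~~ b) @^-1` thickening A e))%E.
    by apply: le_mm_measure => // x /=; exact: thickening_closure.
  have m3 := le_trans m1 (leeD2r e%:E m2).
  rewrite (_ : 1 - (t + 2 * e) = 1 - t - 2 * e); last by lra.
  rewrite EFinB leeBlDr//; apply: le_trans m3 _; rewrite leeD2l// lee_fin.
  by have := e_gt0; lra.
Qed.

Definition ambient_complex b (a : index R 3) : simplicial_complex (set Z) :=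
  chain_complex (fun A C => A `<=` C)
    (ambient_vertex b (a 0)%:num (a 1)%:num (a 2)%:num).

Lemma ambient_complex_mono b (a a' : index R 3) : index_le a a' ->
  simplex (ambient_complex b a) `<=` simplex (ambient_complex b a').
Proof. by move=> aa'; apply: chain_complex_mono; exact: ambient_vertex_mono. Qed.

(** Inverse and direct images along the embedding form a Galois connection; as
  the direct image of the inverse image of [A] is smaller than [A], it is the
  reversed inclusion that is used. *)
Lemma ambient_VR3 b :
  weakly_equivalent (filtration_functor (@ambient_complex_mono b)) (VR3 (W b)).
Proof.
have [h_iso h_proj] := h_emb b.
have h_inj : injective (@h b).
  by move=> x y hxy; apply: mdist_positivity; rewrite -h_iso hxy mdistxx.
have hK (A : set (W b)) : @h b @^-1` (@h b @` A) = A.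
  apply/seteqP; split=> [x [y Ay /h_inj <-]//|x Ax]; exact: imageP.
rewrite /VR3; apply: (@chain_weakly_equivalent _ _ _ _ _ _ _ _
  (fun A C : set Z => C `<=` A) (fun A C : set (W b) => C `<=` A)
  (fun a => ambient_vertex b (a 0)%:num (a 1)%:num (a 2)%:num)
  (fun a => [set A | [/\ borel A, (diam A <= (a 0)%:num%:E)%E,
      (rad (@bf_proj _ _ (W b) @` A) <= ((a 1)%:num / 2)%:E)%E &
      ((1 - (a 2)%:num)%:E <= mm_measure (W b) A)%E]])
  (fun A => @h b @^-1` A) (fun A => @h b @` A)).
- move=> a s; split=> -[fs s0 cs sP]; split=> // v w sv sw;
    by have [] := cs v w sv sw; [right|left].
- move=> a s; split=> -[fs s0 cs sP]; split=> // v w sv sw;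
    by have [] := cs v w sv sw; [right|left].
- by move=> A C D CA DC; exact: subset_trans CA.
- by move=> A C CA; exact: preimage_subset.
- by move=> A C CA; exact: image_subset.
- move=> a A [bA dA rA mA]; split=> //.
  + apply: le_trans dA; rewrite -[leRHS]adde0; apply: diam_shift => // x y Ax Ay.
    by exists (h x), (h y); rewrite h_iso addr0.
  + apply: le_trans rA; apply: rad_le => _ [x Ax <-].
    by exists (h x) => //; exact: h_proj.
- move=> a A [bA dA rA mA]; split; rewrite ?hK//.
  + apply: le_trans dA; rewrite -[leRHS]adde0; apply: diam_shift => // _ _ [x Ax <-] [y Ay <-].
    by exists x, y; rewrite h_iso addr0.
  + apply: le_trans rA; apply: rad_le => _ [_ [x Ax <-] <-].
    by exists x => //; rewrite h_proj.
- by [].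
- by move=> A _ [x Ax <-].
Qed.

(** How a subset of [Z] standing for a vertex of [W b] is turned into one for
  [W c]. *)
Definition transport (b c : bool) (A : set Z) : set Z := if b == c then A else thickening A e.

Definition transport_le (v w : bool * set Z) : Prop :=
  transport v.1 w.1 v.2 `<=` w.2.

Lemma transport_sub b c A C : A `<=` C -> transport b c A `<=` transport b c C.
Proof. by move=> AC; rewrite /transport; case: ifP => // _; exact: thickening_sub. Qed.

(** The direct route is contained in any detour: going to the other field and
  back is thickening twice, while staying is the identity. *)
Lemma transport_comp b c d A : transport b d A `<=` transport c d (transport b c A).
Proof.
have e0 := e_gt0; rewrite /transport; case: b c d => [] [] [] //= x Ax;
  by do 2! apply: sub_thickening => //.
Qed.

Lemma transport_le_trans u v w :
  transport_le u v -> transport_le v w -> transport_le u w.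
Proof.
rewrite /transport_le => uv vw.
apply: (subset_trans (@transport_comp u.1 v.1 w.1 u.2)).
by apply: subset_trans vw; exact: transport_sub.
Qed.

(** The delay [2 * e] of the sets of the other field is what their thickening
  costs, so that [transport] brings all vertices into those of [W b]. *)
Definition joint_vertex b (a : index R 3) : set (bool * set Z) :=
  [set v | let d := if v.1 == b then 0 else 2 * e in
    ambient_vertex v.1 ((a 0)%:num - d) ((a 1)%:num - d) ((a 2)%:num - d) v.2].

Definition joint_complex b (a : index R 3) : simplicial_complex (bool * set Z)%type :=
  chain_complex transport_le (joint_vertex b a).

Lemma joint_complex_mono b (a a' : index R 3) : index_le a a' ->
  simplex (joint_complex b a) `<=` simplex (joint_complex b a').
Proof.
move=> aa'; apply: chain_complex_mono => v.
by apply: ambient_vertex_mono; rewrite lerD2r.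
Qed.

(** Transport to [W b] is order-preserving by [transport_comp], and left adjoint
  to the inclusion of the vertices of [W b]. *)
Lemma joint_ambient b : weakly_equivalent
  (filtration_functor (@joint_complex_mono b))
  (filtration_functor (@ambient_complex_mono b)).
Proof.
apply: (@chain_weakly_equivalent _ _ _ _ _ _ _ _ transport_le
  (fun A C => A `<=` C) (joint_vertex b)
  (fun a => ambient_vertex b (a 0)%:num (a 1)%:num (a 2)%:num)
  (fun v => transport v.1 b v.2) (fun A => (b, A))) => //.
- exact: transport_le_trans.
- move=> v w vw; apply: (subset_trans (@transport_comp v.1 w.1 b v.2)).
  exact: transport_sub.
- by move=> A C AC; rewrite /transport_le /transport/= eqxx.
- move=> a [c A]; rewrite /joint_vertex /transport /=.
  have [->|cb] := eqVneq c b; first by rewrite !subr0.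
  move=> /ambient_vertex_thickening; rewrite !subrK.
  by have -> : ~~ c = b by case: c b cb => [] [].
- by move=> a A; rewrite /joint_vertex /= eqxx !subr0.
- by move=> A; rewrite /transport eqxx.
- by move=> v; rewrite /transport_le /=.
Qed.

Lemma joint_shift b (d : {nonneg R}) a : d%:num = 2 * e ->
  simplex (joint_complex b a) `<=` simplex (joint_complex (~~ b) (shift d a)).
Proof.
move=> dE; apply: chain_complex_mono => -[c A]; rewrite /joint_vertex /=.
have -> : (c == ~~ b) = (c != b) by case: c b => [] [].
have e0 := e_gt0.
by apply: ambient_vertex_mono; rewrite dE; case: (eqVneq c b) => _ /=; lra.
Qed.

Lemma VR3_interleaved (d : {nonneg R}) : d%:num = 2 * e ->
  homotopy_interleaved d (VR3 (W false)) (VR3 (W true)).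
Proof.
move=> dE; exists (filtration_functor (@joint_complex_mono false)),
  (filtration_functor (@joint_complex_mono true)); split.
- by apply: Relation_Operators.rst_sym; apply: Relation_Operators.rst_trans (joint_ambient _) (ambient_VR3 _).
- by apply: Relation_Operators.rst_sym; apply: Relation_Operators.rst_trans (joint_ambient _) (ambient_VR3 _).
- by apply: inclusion_interleaved => a; exact: joint_shift dE.
Qed.

End gromov_prokhorov.

Lemma d_HI_VR3_le (R : realType) (B : metricType R) (X Y : mmField B) :
  (d_HI (VR3 X) (VR3 Y) <= 2%:E * d_GP X Y)%E.
Proof.
apply: mul2_inf => _ [Z [f [g [ef eg ->]]]]; apply: mul2_inf => _ [e [e0 pr] <-].
have e2 : 0 <= 2 * e by rewrite mulr_ge0// ltW.
apply: (d_HI_le (e0 := e2)).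
pose W b := if b then Y else X.
pose h b : W b -> Z := if b as b' return W b' -> Z then g else f.
apply: (@VR3_interleaved R B Z W h e e0) => //.
- by case.
- by move=> [] A bA; have [] := pr A bA.
Qed.

Theorem theorem7p6 (R : realType) (B : metricType R) (hB : polish_metric B)
    (X Y : mmField B) :
  (d_HI (VR2 X) (VR2 Y) <= 2%:E * d_GH X Y)%E /\
  (d_HI (VR3 X) (VR3 Y) <= 2%:E * d_GP X Y)%E.
Proof. by split; [exact: d_HI_VR2_le|exact: d_HI_VR3_le]. Qed.
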